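(* Assume the correction factors are computed as in the context. Let $(Y^n,P^{n-1},U^n)$, $n=1,\dots,N_0$, be a solution of the fully-discrete AFC scheme (in the matrix form given in the context), with nodal coefficient vectors $\boldsymbol\alpha^n$ of $Y^n$ and $\boldsymbol\beta^{n}$ of $P^{n}$. Then, for all $k,h$, it satisfies the global discrete maximum principle, i.e., for every $n=1,\dots,N_0$ and every interior node index $i\in\mathcal N_h^0$, with $$\alpha^{\max,n-1}=\max_{j\in\mathcal N_h}\alpha_j^{n-1},\quad\alpha^{\min,n-1}=\min_{j\in\mathcal N_h}\alpha_j^{n-1},\quad\beta^{\max,n}=\max_{j\in\mathcal N_h}\beta_j^{n},\quad\beta^{\min,n}=\min_{j\in\mathcal N_h}\beta_j^{n},$$ the following hold. If $\sigma>0$: $G^n+BU^n\le0$ in $\Omega$ implies $\alpha_i^n\le\max\{0,\alpha^{\max,n-1}\}$; $G^n+BU^n\ge0$ in $\Omega$ implies $\alpha_i^n\ge\min\{0,\alpha^{\min,n-1}\}$; $Y^n-y_d^n\le0$ in $\Omega$ implies $\beta_i^{n-1}\le\max\{0,\beta^{\max,n}\}$; $Y^n-y_d^n\ge0$ in $\Omega$ implies $\beta_i^{n-1}\ge\min\{0,\beta^{\min,n}\}$. If $\sigma=0$: $G^n+BU^n\le0$ in $\Omega$ implies $\alpha_i^n\le\alpha^{\max,n-1}$; $G^n+BU^n\ge0$ in $\Omega$ implies $\alpha_i^n\ge\alpha^{\min,n-1}$; $Y^n-y_d^n\le0$ in $\Omega$ implies $\beta_i^{n-1}\le\beta^{\max,n}$;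 $Y^n-y_d^n\ge0$ in $\Omega$ implies $\beta_i^{n-1}\ge\beta^{\min,n}$.
   Context: **Data.** $\Omega\subset\mathbb R^2$ is a bounded convex polygonal domain, $T>0$; $(\cdot,\cdot)$ is the $L^2(\Omega)$ inner product. Given are constants $\mu>0$, $\sigma\ge0$, $\lambda>0$, $\mathsf{u_a}<\mathsf{u_b}$; a field $\mathbf b=\mathbf b(x,t)$ with $\mathbf b(\cdot,t)\in[W^1_\infty(\Omega)]^2$ and $\sigma-\frac12\operatorname{div}\mathbf b\ge\sigma_0>0$; functions $G,y_d$ with values in $L^2(\Omega)$; a bounded linear operator $B$ on $L^2(0,T;L^2)$ with adjoint $B^*$, also applied at fixed times to functions of $L^2(\Omega)$. $\Pi(v)=\max\{\mathsf{u_a},\min\{\mathsf{u_b},v\}\}$. **Discretization.** $\mathcal T_h$ belongs to a family of conforming triangulations of $\overline\Omega$, shape regular, quasi-uniform and with all triangle angles less than $\pi/2$; $h$ is the maximal diameter. Nodes $Z_i$, $i\in\mathcal N_h=\{1,\dots,N\}$ (interior and boundary nodes); $\mathcal N_h^0$ = indices of interior nodes; $\mathcal Z_h^i$ = indices of nodes adjacent to $Z_i$; $\omega_i$ = union of triangles with vertex $Z_i$; $\phi_i$ = nodal hat functions. $S_h$ = continuous piecewise linear functions vanishing on $\partial\Omega$ (nodal coefficients at boundary nodes are zero). Matrices: $\mathbf M=(m_{ij})$, $m_{ij}=(\phi_i,\phi_j)$; $\mathbf M_L=\mathrm{diag}(m_i)$, $m_i=\sum_jm_{ij}$; $\mathbf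 S=(s_{ij})$, $s_{ij}=(\nabla\phi_i,\nabla\phi_j)$; $\mathbf T=(\tau_{ij})$, $\tau_{ij}=(\mathbf b\cdot\nabla\phi_j,\phi_i)$; $\mathbf D=(d_{ij})$, $d_{ij}=\min\{-\tau_{ij},0,-\tau_{ji}\}$ for $j\ne i$, $d_{ii}=-\sum_{j\ne i}d_{ij}$; $\widehat{\mathbf D}=(\widehat d_{ij})$, $\widehat d_{ij}=\max\{-\tau_{ij},0,-\tau_{ji}\}$ for $j\neq i$, $\widehat d_{ii}=-\sum_{j\ne i}\widehat d_{ij}$. For $s\in L^2$, $\mathbf r(s)=((s,\phi_i))_i$. Time-dependent coefficients are evaluated at the time level of the equation in question. **Correction factors.** For symmetric weights $c_{ij}\ge0$ ($i\neq j$) and vectors $\psi,\zeta\in\mathbb R^N$ let, for $i\in\mathcal N_h^0$, $P_i^+=\sum_{j\in\mathcal Z_h^i}\max\{0,c_{ij}(\psi_i-\psi_j)\}$, $P_i^-=\sum_{j\in\mathcal Z_h^i}\min\{0,c_{ij}(\psi_i-\psi_j)\}$, $Q_i^+=q_i(\zeta_i^{\max}-\zeta_i)$, $Q_i^-=q_i(\zeta_i^{\min}-\zeta_i)$, where $\zeta_i^{\max},\zeta_i^{\min}$ are the max/min of $\zeta$ over the nodes of $\omega_i$ (including $Z_i$), $q_i=\gamma_i\sum_{j\in\mathcal Z_h^i}c_{ij}$ and $\gamma_i=\max_{Z_j\in\partial\omega_i}|Z_i-Z_j|/\mathrm{dist}(Z_i,\partial\omega_i^{\rm conv})$ ($\omega_i^{\rm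 conv}$ the convex hull of $\omega_i$). $R_i^\pm=\min\{1,Q_i^\pm/P_i^\pm\}$ ($=1$ if $P_i^\pm=0$). $\overline a_{ij}=R_i^+$, $1$, $R_i^-$ according as $c_{ij}(\psi_i-\psi_j)$ is $>0$, $=0$, $<0$; for $i$ a boundary index $\overline a_{ij}=1$. Finally $a_{ij}^{c}(\psi,\zeta)=\min\{\overline a_{ij},\overline a_{ji}\}$. **Scheme in matrix form.** $N_0\ge1$, $k=T/N_0$, $t^n=nk$, $v^n=v(\cdot,t^n)$. $Y^0\in S_h$ is given, $P^{N_0}=0$. For $n=1,\dots,N_0$, in the rows $i\in\mathcal N_h^0$: $(\mathbf M_L+k(\mu\mathbf S+\mathbf T+\mathbf D+\sigma\mathbf M_L))\boldsymbol\alpha^n=\mathbf M_L\boldsymbol\alpha^{n-1}+k\,\mathbf r(BU^n+G^n)+k\,\overline{\mathsf f}+\overline{\mathsf g}$, $(\mathbf M_L+k(\mu\mathbf S-\mathbf T-\widehat{\mathbf D}+\sigma\mathbf M_L))\boldsymbol\beta^{n-1}=\mathbf M_L\boldsymbol\beta^{n}+k\mathbf M\boldsymbol\alpha^n-k\,\mathbf r(y_d^n)+k\,\overline{\widehat{\mathsf f}}+\overline{\widehat{\mathsf g}}$, and $U^n=\Pi(-\lambda^{-1}B^*P^{n-1})$, where $\overline{\mathsf f}_i=\sum_{j\ne i}a^{|d|}_{ij}(\boldsymbol\alpha^n,\boldsymbol\alpha^n)\,d_{ij}(\alpha_j^n-\alpha_i^n)$ (weights $c_{ij}=|d_{ij}|$),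 $\overline{\widehat{\mathsf f}}_i=\sum_{j\ne i}a^{\widehat d}_{ij}(\boldsymbol\beta^{n-1},\boldsymbol\beta^{n-1})\,\widehat d_{ij}(\beta_i^{n-1}-\beta_j^{n-1})$ (weights $\widehat d_{ij}$), $\overline{\mathsf g}_i=\sum_{j\ne i}a^{m}_{ij}(\boldsymbol\alpha^n-\boldsymbol\alpha^{n-1},\boldsymbol\alpha^n)\,m_{ij}\big((\alpha_i^n-\alpha_i^{n-1})-(\alpha_j^n-\alpha_j^{n-1})\big)$ (weights $m_{ij}$), $\overline{\widehat{\mathsf g}}_i=\sum_{j\ne i}a^{m}_{ij}(\boldsymbol\beta^{n-1}-\boldsymbol\beta^{n},\boldsymbol\beta^{n-1})\,m_{ij}\big((\beta_i^{n-1}-\beta_i^{n})-(\beta_j^{n-1}-\beta_j^{n})\big)$. *)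

(* Defs.v *)
From HB Require Import structures.
From mathcomp Require Import all_boot all_order all_algebra.
From mathcomp Require Import all_classical all_reals all_analysis.

Set Implicit Arguments.
Unset Strict Implicit.
Unset Printing Implicit Defensive.
Import Order.TTheory GRing.Theory Num.Theory.
Import numFieldNormedType.Exports.

Local Open Scope classical_set_scope.
Local Open Scope ring_scope.

(* The library norm of [R * R] is the sup norm, hence the separate Euclidean
   norm; both induce the same topology. *)
Definition dot {R : realType} (u v : R * R) : R := u.1 * v.1 + u.2 * v.2.

Definition enorm {R : realType} (u : R * R) : R := Num.sqrt (dot u u).

Definition conv_hull {R : realType} (A : set (R * R)) : set (R * R) :=
  smallest (@convex_set R (R * R)%type) A.

Definition boundary {R : realType} (A : set (R * R)) : set (R * R) :=
  closure A `\` interior A.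

Definition dist_to {R : realType} (x : R * R) (A : set (R * R)) : R :=
  inf [set enorm (x - y) | y in A].

Definition diameter {R : realType} (A : set (R * R)) : R :=
  sup [set enorm (z.1 - z.2) | z in A `*` A].

(* Angle at [a] in the triangle [a b c]. *)
Definition angle {R : realType} (a b c : R * R) : R :=
  acos (dot (b - a) (c - a) / (enorm (b - a) * enorm (c - a))).

Definition convex_polygonal_domain {R : realType} (Omega : set (R * R)) : Prop :=
  [/\ open Omega, Omega !=set0, convex_set Omega, bounded_set Omega &
      exists V : seq (R * R), closure Omega = conv_hull [set` V]].

Definition leb2 (R : realType) :
    {measure set (measurableTypeR R * measurableTypeR R) -> \bar R} :=
  (@lebesgue_measure R \x @lebesgue_measure R)%E.

Definition leb3 (R : realType) :
    {measure set ((measurableTypeR R * measurableTypeR R) *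
                  measurableTypeR R) -> \bar R} :=
  ((@lebesgue_measure R \x @lebesgue_measure R) \x @lebesgue_measure R)%E.

(* Elements of L^p(D) are represented by functions defined on the whole space,
   of which only the values on [D] matter. *)
Definition Lp_on {d : measure_display} {X : measurableType d} {R : realType}
    (m : {measure set X -> \bar R}) (p : \bar R) (D : set X) (f : X -> R) : Prop :=
  (f \* \1_D) \in Lfun m p.

Definition L2_on {d : measure_display} {X : measurableType d} {R : realType}
    (m : {measure set X -> \bar R}) (D : set X) (f : X -> R) : Prop :=
  Lp_on m 2%:E D f.

Definition bounded_linear_on {d : measure_display} {X : measurableType d}
    {R : realType} (m : {measure set X -> \bar R}) (D : set X)
    (A : (X -> R) -> (X -> R)) : Prop :=
  [/\ forall f, L2_on m D f -> L2_on m D (A f),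
      forall (a : R) f g, L2_on m D f -> L2_on m D g ->
        {ae m, forall x, D x -> A (fun y => a * f y + g y) x = a * A f x + A g x} &
      exists C : R, forall f, L2_on m D f ->
        ('N[m]_2%:E[EFin \o (A f \* \1_D)%R] <=
         C%:E * 'N[m]_2%:E[EFin \o (f \* \1_D)%R])%E].

Definition adjoint_on {d : measure_display} {X : measurableType d}
    {R : realType} (m : {measure set X -> \bar R}) (D : set X)
    (A As : (X -> R) -> (X -> R)) : Prop :=
  forall f g, L2_on m D f -> L2_on m D g ->
    \int[m]_(x in D) (A f x * g x) = \int[m]_(x in D) (f x * As g x).

Definition L2 {R : realType} (Omega : set (R * R)) (f : R * R -> R) : Prop :=
  L2_on (leb2 R) Omega f.

Definition ip {R : realType} (Omega : set (R * R)) (f g : R * R -> R) : R :=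
  \int[leb2 R]_(x in Omega) (f x * g x).

Definition ipv {R : realType} (Omega : set (R * R)) (f g : R * R -> R * R) : R :=
  \int[leb2 R]_(x in Omega) dot (f x) (g x).

Definition grad {R : realType} (f : R * R -> R) (x : R * R) : R * R :=
  ('D_((1, 0) : R * R) f x, 'D_((0, 1) : R * R) f x).

Definition iter_deriv {R : realType} (s : seq (R * R)) (f : R * R -> R) :
    R * R -> R :=
  foldr (fun v g x => 'D_v g x) f s.

Definition test_function {R : realType} (Omega : set (R * R))
    (psi : R * R -> R) : Prop :=
  (forall (s : seq (R * R)) (v x : R * R),
     derivable (iter_deriv s psi) x v /\ {for x, continuous (iter_deriv s psi)}) /\
  exists K : set (R * R), [/\ compact K, K `<=` Omega &
    forall x, ~ K x -> psi x = 0].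

Definition weak_grad {R : realType} (Omega : set (R * R)) (f : R * R -> R)
    (g : R * R -> R * R) : Prop :=
  forall psi, test_function Omega psi ->
    ip Omega f (fun x => (grad psi x).1) = - ip Omega (fun x => (g x).1) psi /\
    ip Omega f (fun x => (grad psi x).2) = - ip Omega (fun x => (g x).2) psi.

Definition W1oo_with_grad {R : realType} (Omega : set (R * R)) (f : R * R -> R)
    (g : R * R -> R * R) : Prop :=
  [/\ Lp_on (leb2 R) +oo%E Omega f,
      Lp_on (leb2 R) +oo%E Omega (fun x => (g x).1),
      Lp_on (leb2 R) +oo%E Omega (fun x => (g x).2) & weak_grad Omega f g].

(* The operator B on L^2(0,T;L^2(Omega)) = L^2(Omega x (0,T)) and its adjoint
   are [Bop], [Bsop]; their actions on L^2(Omega) at a fixed time are [Bat],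
   [Bsat]. *)
Record ocp (R : realType) := Ocp {
  Omega : set (R * R);
  Tend : R;
  mu : R;
  sigma : R;
  lambda : R;
  ua : R;
  ub : R;
  bfield : R -> R * R -> R * R;
  Gfun : R -> R * R -> R;
  ydfun : R -> R * R -> R;
  Bop : ((R * R) * R -> R) -> (R * R) * R -> R;
  Bsop : ((R * R) * R -> R) -> (R * R) * R -> R;
  Bat : R -> (R * R -> R) -> R * R -> R;
  Bsat : R -> (R * R -> R) -> R * R -> R
}.

Definition cylinder {R : realType} (p : ocp R) : set ((R * R) * R) :=
  Omega p `*` `]0, Tend p[.

Definition acts_pointwise_in_time {R : realType} (p : ocp R)
    (A : ((R * R) * R -> R) -> (R * R) * R -> R)
    (At : R -> (R * R -> R) -> R * R -> R) : Prop :=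
  forall u, L2_on (leb3 R) (cylinder p) u ->
    {ae @lebesgue_measure R, forall t, 0 < t < Tend p ->
      {ae leb2 R, forall x, Omega p x -> A u (x, t) = At t (fun y => u (y, t)) x}}.

Definition field_assumption {R : realType} (p : ocp R) (sigma0 : R) : Prop :=
  forall t, 0 <= t <= Tend p ->
    exists g1 g2 : R * R -> R * R,
      [/\ W1oo_with_grad (Omega p) (fun x => (bfield p t x).1) g1,
          W1oo_with_grad (Omega p) (fun x => (bfield p t x).2) g2 &
          {ae leb2 R, forall x, Omega p x ->
            sigma0 <= sigma p - 2^-1 * ((g1 x).1 + (g2 x).2)}].

Definition control_operator_assumption {R : realType} (p : ocp R) : Prop :=
  [/\ bounded_linear_on (leb3 R) (cylinder p) (Bop p),
      bounded_linear_on (leb3 R) (cylinder p) (Bsop p) &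
      adjoint_on (leb3 R) (cylinder p) (Bop p) (Bsop p)] /\
  [/\ acts_pointwise_in_time p (Bop p) (Bat p),
      acts_pointwise_in_time p (Bsop p) (Bsat p) &
      forall t, 0 <= t <= Tend p ->
        [/\ bounded_linear_on (leb2 R) (Omega p) (Bat p t),
            bounded_linear_on (leb2 R) (Omega p) (Bsat p t) &
            adjoint_on (leb2 R) (Omega p) (Bat p t) (Bsat p t)]].

Definition standing_assumptions {R : realType} (p : ocp R) : Prop :=
  [/\ convex_polygonal_domain (Omega p),
      0 < Tend p,
      [/\ 0 < mu p, 0 <= sigma p, 0 < lambda p & ua p < ub p],
      exists2 sigma0 : R, 0 < sigma0 & field_assumption p sigma0 &
      (forall t, 0 <= t <= Tend p ->
         L2 (Omega p) (Gfun p t) /\ L2 (Omega p) (ydfun p t)) /\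
      control_operator_assumption p].

Definition projPi {R : realType} (p : ocp R) (v : R) : R :=
  Num.max (ua p) (Num.min (ub p) v).

(* The index set of the nodes is ['I_(nlast M).+1] (N = nlast M + 1); a triangle
   is given by the set of its three vertices. *)
Record mesh (R : realType) := Mesh {
  nlast : nat;
  node : 'I_nlast.+1 -> R * R;
  tri : {set {set 'I_nlast.+1}}
}.

Arguments node {R} m _.

Definition cell {R : realType} (M : mesh R) (t : {set 'I_(nlast M).+1}) :
    set (R * R) :=
  conv_hull [set node M i | i in [set` t]].

Definition conforming {R : realType} (Omega : set (R * R)) (M : mesh R) : Prop :=
  [/\ injective (node M),
      forall t, t \in tri M -> #|t| = 3%N /\ interior (cell t) !=set0,
      forall i, exists2 t, t \in tri M & i \in t,
      \bigcup_(t in [set` tri M]) cell t = closure Omega &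
      forall t t', t \in tri M -> t' \in tri M ->
        cell t `&` cell t' = cell (t :&: t')].

Definition acute {R : realType} (M : mesh R) : Prop :=
  forall t i j l, t \in tri M -> i \in t -> j \in t -> l \in t ->
    i != j -> i != l -> j != l ->
    angle (node M i) (node M j) (node M l) < pi / 2.

Definition meshsize {R : realType} (M : mesh R) : R :=
  \big[Num.max/0]_(t in tri M) diameter (cell t).

Definition shape_regular {R : realType} (F : set (mesh R)) : Prop :=
  exists2 kappa : R, 0 < kappa &
    forall M, F M -> forall t, t \in tri M -> exists c : R * R,
      [set x | enorm (x - c) <= kappa * diameter (cell t)] `<=` cell t.

Definition quasi_uniform {R : realType} (F : set (mesh R)) : Prop :=
  exists2 kappa : R, 0 < kappa &
    forall M, F M -> forall t, t \in tri M ->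
      kappa * meshsize M <= diameter (cell t).

Definition mesh_family {R : realType} (Omega : set (R * R)) (F : set (mesh R)) :
    Prop :=
  [/\ forall M, F M -> conforming Omega M /\ acute M,
      shape_regular F & quasi_uniform F].

Definition interior_node {R : realType} (Omega : set (R * R)) (M : mesh R)
    (i : 'I_(nlast M).+1) : bool :=
  `[< Omega (node M i) >].

Definition neighbor {R : realType} (M : mesh R) (i j : 'I_(nlast M).+1) : bool :=
  (j != i) && [exists t in tri M, (i \in t) && (j \in t)].

Definition star {R : realType} (M : mesh R) (i : 'I_(nlast M).+1) : set (R * R) :=
  \bigcup_(t in [set t | (t \in tri M) && (i \in t)]) cell t.

Definition piecewise_linear {R : realType} (Omega : set (R * R)) (M : mesh R)
    (v : R * R -> R) : Prop :=
  {within closure Omega, continuous v} /\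
  forall t, t \in tri M -> exists (a : R * R) (c : R),
    forall x, cell t x -> v x = dot a x + c.

Definition Sh {R : realType} (Omega : set (R * R)) (M : mesh R)
    (v : R * R -> R) : Prop :=
  piecewise_linear Omega M v /\ forall x, boundary Omega x -> v x = 0.

Definition nodal_basis {R : realType} (Omega : set (R * R)) (M : mesh R)
    (phi : 'I_(nlast M).+1 -> R * R -> R) : Prop :=
  forall i, piecewise_linear Omega M (phi i) /\
            forall j, phi i (node M j) = (i == j)%:R.

Definition coefs {R : realType} (M : mesh R) (v : R * R -> R) :
    'cV[R]_((nlast M).+1) :=
  \col_i v (node M i).

(* Weak gradient of a continuous piecewise linear function: the representative
   that vanishes on the edges, a null set where the gradient jumps. *)
Definition pgrad {R : realType} (M : mesh R) (v : R * R -> R) (x : R * R) : R * R :=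
  if `[< exists2 t, t \in tri M & interior (cell t) x >] then grad v x else 0.

Definition Mmx {R : realType} (Omega : set (R * R)) (M : mesh R)
    (phi : 'I_(nlast M).+1 -> R * R -> R) : 'M[R]_((nlast M).+1) :=
  \matrix_(i, j) ip Omega (phi i) (phi j).

Definition MLmx {R : realType} (Omega : set (R * R)) (M : mesh R)
    (phi : 'I_(nlast M).+1 -> R * R -> R) : 'M[R]_((nlast M).+1) :=
  diag_mx (\row_i \sum_j Mmx Omega phi i j).

Definition Smx {R : realType} (Omega : set (R * R)) (M : mesh R)
    (phi : 'I_(nlast M).+1 -> R * R -> R) : 'M[R]_((nlast M).+1) :=
  \matrix_(i, j) ipv Omega (pgrad M (phi i)) (pgrad M (phi j)).

Definition Tmx {R : realType} (Omega : set (R * R)) (M : mesh R)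
    (phi : 'I_(nlast M).+1 -> R * R -> R) (b : R * R -> R * R) :
    'M[R]_((nlast M).+1) :=
  \matrix_(i, j) ip Omega (fun x => dot (b x) (pgrad M (phi j) x)) (phi i).

Definition zero_row_sum {R : realType} (n : nat) (e : 'I_n -> 'I_n -> R) :
    'M[R]_n :=
  \matrix_(i, j) if i == j then - \sum_(l | l != i) e i l else e i j.

Definition Dmx {R : realType} (n : nat) (tau : 'M[R]_n) : 'M[R]_n :=
  zero_row_sum (fun i j => Num.min (- tau i j) (Num.min 0 (- tau j i))).

Definition Dhmx {R : realType} (n : nat) (tau : 'M[R]_n) : 'M[R]_n :=
  zero_row_sum (fun i j => Num.max (- tau i j) (Num.max 0 (- tau j i))).

Definition rvec {R : realType} (Omega : set (R * R)) (M : mesh R)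
    (phi : 'I_(nlast M).+1 -> R * R -> R) (s : R * R -> R) :
    'cV[R]_((nlast M).+1) :=
  \col_i ip Omega s (phi i).

Definition Pplus {R : realType} (M : mesh R) (c : 'M[R]_((nlast M).+1))
    (psi : 'cV[R]_((nlast M).+1)) (i : 'I_(nlast M).+1) : R :=
  \sum_(j | neighbor i j) Num.max 0 (c i j * (psi i 0 - psi j 0)).

Definition Pminus {R : realType} (M : mesh R) (c : 'M[R]_((nlast M).+1))
    (psi : 'cV[R]_((nlast M).+1)) (i : 'I_(nlast M).+1) : R :=
  \sum_(j | neighbor i j) Num.min 0 (c i j * (psi i 0 - psi j 0)).

Definition gamma {R : realType} (M : mesh R) (i : 'I_(nlast M).+1) : R :=
  (\big[Num.max/0]_(j | `[< boundary (star i) (node M j) >])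
     enorm (node M i - node M j)) /
  dist_to (node M i) (boundary (conv_hull (star i))).

Definition qcoef {R : realType} (M : mesh R) (c : 'M[R]_((nlast M).+1))
    (i : 'I_(nlast M).+1) : R :=
  gamma i * \sum_(j | neighbor i j) c i j.

Definition Qplus {R : realType} (M : mesh R) (c : 'M[R]_((nlast M).+1))
    (zeta : 'cV[R]_((nlast M).+1)) (i : 'I_(nlast M).+1) : R :=
  qcoef c i *
  (\big[Num.max/zeta i 0]_(j | neighbor i j) zeta j 0 - zeta i 0).

Definition Qminus {R : realType} (M : mesh R) (c : 'M[R]_((nlast M).+1))
    (zeta : 'cV[R]_((nlast M).+1)) (i : 'I_(nlast M).+1) : R :=
  qcoef c i *
  (\big[Num.min/zeta i 0]_(j | neighbor i j) zeta j 0 - zeta i 0).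

Definition Rfactor {R : realType} (Q P : R) : R :=
  if P == 0 then 1 else Num.min 1 (Q / P).

Definition abar {R : realType} (Omega : set (R * R)) (M : mesh R)
    (c : 'M[R]_((nlast M).+1)) (psi zeta : 'cV[R]_((nlast M).+1))
    (i j : 'I_(nlast M).+1) : R :=
  let s := c i j * (psi i 0 - psi j 0) in
  if ~~ interior_node Omega i then 1
  else if 0 < s then Rfactor (Qplus c zeta i) (Pplus c psi i)
  else if s < 0 then Rfactor (Qminus c zeta i) (Pminus c psi i)
  else 1.

Definition acorr {R : realType} (Omega : set (R * R)) (M : mesh R)
    (c : 'M[R]_((nlast M).+1)) (psi zeta : 'cV[R]_((nlast M).+1))
    (i j : 'I_(nlast M).+1) : R :=
  Num.min (abar Omega c psi zeta i j) (abar Omega c psi zeta j i).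

Definition fbar {R : realType} (Omega : set (R * R)) (M : mesh R)
    (D : 'M[R]_((nlast M).+1)) (alpha : 'cV[R]_((nlast M).+1)) :
    'cV[R]_((nlast M).+1) :=
  \col_i \sum_(j | j != i)
    acorr Omega (map_mx Num.norm D) alpha alpha i j *
      (D i j * (alpha j 0 - alpha i 0)).

Definition fhbar {R : realType} (Omega : set (R * R)) (M : mesh R)
    (Dh : 'M[R]_((nlast M).+1)) (beta : 'cV[R]_((nlast M).+1)) :
    'cV[R]_((nlast M).+1) :=
  \col_i \sum_(j | j != i)
    acorr Omega Dh beta beta i j * (Dh i j * (beta i 0 - beta j 0)).

(* [new] and [old] are the unknown and the known time level of the equation, so
   that the same formula serves the state and the adjoint equation. *)
Definition gbar {R : realType} (Omega : set (R * R)) (M : mesh R)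
    (mass : 'M[R]_((nlast M).+1)) (new old : 'cV[R]_((nlast M).+1)) :
    'cV[R]_((nlast M).+1) :=
  \col_i \sum_(j | j != i)
    acorr Omega mass (new - old) new i j *
      (mass i j * ((new i 0 - old i 0) - (new j 0 - old j 0))).

Definition tstep {R : realType} (p : ocp R) (N0 : nat) : R := Tend p / N0%:R.

Definition tlev {R : realType} (p : ocp R) (N0 n : nat) : R := n%:R * tstep p N0.

Definition source {R : realType} (p : ocp R) (N0 : nat) (U : nat -> R * R -> R)
    (n : nat) (x : R * R) : R :=
  Bat p (tlev p N0 n) (U n) x + Gfun p (tlev p N0 n) x.

Definition state_equation {R : realType} (p : ocp R) (M : mesh R)
    (phi : 'I_(nlast M).+1 -> R * R -> R) (N0 : nat)
    (Y U : nat -> R * R -> R) (n : nat) (i : 'I_(nlast M).+1) : Prop :=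
  let k := tstep p N0 in
  let mass := Mmx (Omega p) phi in
  let ML := MLmx (Omega p) phi in
  let S := Smx (Omega p) phi in
  let T := Tmx (Omega p) phi (bfield p (tlev p N0 n)) in
  let D := Dmx T in
  let alpha m := coefs M (Y m) in
  ((ML + k *: (mu p *: S + T + D + sigma p *: ML)) *m alpha n) i 0 =
  (ML *m alpha n.-1 + k *: rvec (Omega p) phi (source p N0 U n)
   + k *: fbar (Omega p) D (alpha n)
   + gbar (Omega p) mass (alpha n) (alpha n.-1)) i 0.

(* [tb] is the time at which the field is evaluated. *)
Definition adjoint_equation {R : realType} (p : ocp R) (M : mesh R)
    (phi : 'I_(nlast M).+1 -> R * R -> R) (N0 : nat) (tb : R)
    (Y P : nat -> R * R -> R) (n : nat) (i : 'I_(nlast M).+1) : Prop :=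
  let k := tstep p N0 in
  let mass := Mmx (Omega p) phi in
  let ML := MLmx (Omega p) phi in
  let S := Smx (Omega p) phi in
  let T := Tmx (Omega p) phi (bfield p tb) in
  let Dh := Dhmx T in
  let alpha m := coefs M (Y m) in
  let beta m := coefs M (P m) in
  ((ML + k *: (mu p *: S - T - Dh + sigma p *: ML)) *m beta n.-1) i 0 =
  (ML *m beta n + k *: (mass *m alpha n)
   - k *: rvec (Omega p) phi (ydfun p (tlev p N0 n))
   + k *: fhbar (Omega p) Dh (beta n.-1)
   + gbar (Omega p) mass (beta n.-1) (beta n)) i 0.

Definition control_equation {R : realType} (p : ocp R) (tB : R)
    (P U : nat -> R * R -> R) (n : nat) : Prop :=
  {ae leb2 R, forall x, Omega p x ->
    U n x = projPi p (- (lambda p)^-1 * Bsat p tB (P n.-1) x)}.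

(* The adjoint equation of index [n] links the levels [n.-1] and [n]; [eb] and
   [eB] tell whether b in it, respectively B^* in the formula for U^n, is taken
   at level [n] ([false]) or at level [n.-1] ([true]). *)
Definition afc_solution {R : realType} (p : ocp R) (M : mesh R)
    (phi : 'I_(nlast M).+1 -> R * R -> R) (N0 : nat) (eb eB : bool)
    (Y0 : R * R -> R) (Y P U : nat -> R * R -> R) : Prop :=
  [/\ (forall n, (n <= N0)%N -> Sh (Omega p) M (Y n) /\ Sh (Omega p) M (P n)) /\
      (forall n, (1 <= n <= N0)%N -> L2 (Omega p) (U n)),
      forall x, closure (Omega p) x -> Y 0%N x = Y0 x,
      forall x, closure (Omega p) x -> P N0 x = 0,
      forall n i, (1 <= n <= N0)%N -> interior_node (Omega p) i ->
        state_equation p phi N0 Y U n i /\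
        adjoint_equation p phi N0 (tlev p N0 (n - eb)) Y P n i &
      forall n, (1 <= n <= N0)%N ->
        control_equation p (tlev p N0 (n - eB)) P U n].

Definition vmax {R : realType} (n : nat) (v : 'cV[R]_(n.+1)) : R :=
  \big[Num.max/v ord0 0]_j v j 0.

Definition vmin {R : realType} (n : nat) (v : 'cV[R]_(n.+1)) : R :=
  \big[Num.min/v ord0 0]_j v j 0.

Definition nonpos_in {R : realType} (Omega : set (R * R)) (f : R * R -> R) : Prop :=
  {ae leb2 R, forall x, Omega x -> f x <= 0}.

Definition nonneg_in {R : realType} (Omega : set (R * R)) (f : R * R -> R) : Prop :=
  {ae leb2 R, forall x, Omega x -> 0 <= f x}.

(* Main.v *)
Require Import Defs.
From mathcomp Require Import all_boot all_order all_algebra.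
From mathcomp Require Import all_classical all_reals all_analysis.
From mathcomp Require Import measurable_realfun ess_sup_inf ring lra.
Set Implicit Arguments.
Unset Strict Implicit.
Unset Printing Implicit Defensive.
Import Order.TTheory GRing.Theory Num.Theory.
Import numFieldNormedType.Exports.
Local Open Scope classical_set_scope.
Local Open Scope ring_scope.

(* At a node where the new coefficient vector is maximal, [Qplus] vanishes, so
   the limited antidiffusive terms of the equation are nonpositive there. The
   artificial diffusion and the acuteness of the triangles make the remaining
   matrix have nonpositive off-diagonal entries, and its row sums vanish because
   the hat functions add up to 1; hence it only helps at a maximum. What is left
   is (1 + k sigma) x_i <= y_i after division by the positive lumped mass. As
   the old vector vanishes at the boundary nodes, its maximum is nonnegative and
   the cases sigma > 0 and sigma = 0 need not be distinguished. Minima follow by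
   changing signs. *)

(** * Lebesgue measure on the plane *)

(** No restriction on k and h arises because the bounds of the limiter come from the unknown level:
    [Qplus] is built from the new vector even in the mass correction, whose fluxes come from the
    time difference. The position of the maximum alone thus decides which fluxes are switched off.
    Since [acorr] is the smaller of two nonnegative factors, the node at the maximum cancels its
    positive fluxes whatever factor its neighbour asks for, even the factor 1 of a boundary node.
    Both equations are instances of one abstract step. The adjoint matrix contains [- T] and not the
    transpose of [T], so its rows also sum to 0 without integration by parts. Its source is the load
    vector of the difference of Y^n and y_d^n, because the hat functions reproduce Y^n exactly. Much
    of the remaining work is integrability: sums are moved under the integral only for integrable
    functions, and the data are known only through L^2 and L^oo. *)

Local Notation plane R := (measurableTypeR R * measurableTypeR R)%type.

Section PlaneMeasure.
Context {R : realType}.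
Implicit Types U : set (plane R).

(** The sigma-algebra is the product one, so the link to the topology has to come from countably
    many boxes with rational corners. *)
Lemma open_measurable_plane (U : set (R * R)) : open U -> measurable (U : set (plane R)).
Proof.
move=> oU.
pose box (q : (rat * rat) * (rat * rat)) : set (plane R) :=
  `]ratr q.1.1, ratr q.1.2[ `*` `]ratr q.2.1, ratr q.2.2[.
(* Boxes that leave [U] are replaced by the empty set, so that the union runs over the whole
   countable type of rational quadruples. *)
pose sub q := if `[< box q `<=` U >] then box q else set0.
have -> : U = \bigcup_q sub q.
  apply/seteqP; split => [[x y] Uxy|x [q _]]; last first.
    by rewrite /sub; case: asboolP => // bU; exact: bU.
  have [e /= e0 be] := (nbhs_ballP _ _).1 (open_nbhs_nbhs (conj oU Uxy)).
  have itv (z : R) : exists q : rat * rat, ratr q.1 < z < ratr q.2 /\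
      forall w, ratr q.1 < w < ratr q.2 -> ball z e w.
    have /rat_in_itvoo[a] : z - e < z by rewrite ltrBlDr ltrDl.
    have /rat_in_itvoo[b] : z < z + e by rewrite ltrDl.
    rewrite !in_itv /= => /andP[zb be'] /andP[ea az].
    exists (a, b) => /=; split; first by rewrite az.
    move=> w /andP[aw wb]; rewrite /ball /= distrC ltr_distl; apply/andP; split; lra.
  have [q1 [xq1 bq1]] := itv x; have [q2 [yq2 bq2]] := itv y.
  exists (q1, q2) => //; rewrite /sub ifT.
    by split; rewrite /= in_itv.
  apply/asboolP => -[u v] [/=]; rewrite !in_itv /= => uq vq.
  by apply: be; split; [exact: bq1|exact: bq2].
apply: countable_bigcupT_measurable => // q; rewrite /sub.
by case: ifP => _ //; apply: measurableX; exact: measurable_itv.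
Qed.

Lemma box_measure (a b c d : R) : a <= b -> c <= d ->
  leb2 R (`]a, b[ `*` `]c, d[) = ((b - a) * (d - c))%:E.
Proof.
move=> ab cd; rewrite [LHS](product_measure1E lebesgue_measure lebesgue_measure) //.
have len (u v : R) : u <= v ->
    lebesgue_measure (`]u, v[%classic : set (measurableTypeR R)) = (v - u)%:E.
  move=> uv; have := lebesgue_measure_itv `]u, v[; rewrite /= lte_fin => ->.
  by case: ltgtP uv => // -> _; rewrite subrr.
by rewrite EFinM -(len a b) // -(len c d).
Qed.

Lemma bounded_measure_lty (U : set (R * R)) : open U -> bounded_set U ->
  (leb2 R U < +oo)%E.
Proof.
(* [bounded_set] bounds the norm by every number above [C], such as [K]; the further 1 in [K + 1]
   makes the inequalities strict for the open box. *)
move=> oU [C [Creal CU]]; pose K := `|C| + 1.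
have UK : (U : set (plane R)) `<=` `](- (K + 1)), K + 1[ `*` `](- (K + 1)), K + 1[.
  move=> [x y] Uxy; have := CU K; rewrite /K.
  have -> : C < `|C| + 1 by rewrite (le_lt_trans (ler_norm _)) // ltrDl.
  move=> /(_ isT (x, y) Uxy); rewrite /= prod_normE /= ge_max => /andP[xK yK].
  by rewrite !in_itv /= -!ltr_norml; split; rewrite ltr_pwDr.
have K0 : - (K + 1) <= K + 1 by rewrite /K; have := normr_ge0 C; lra.
apply: (@le_lt_trans _ _ (leb2 R (`](- (K + 1)), K + 1[ `*` `](- (K + 1)), K + 1[))).
  apply: le_measure => //; rewrite inE; first exact: open_measurable_plane.
  by apply: measurableX; exact: measurable_itv.
by rewrite box_measure // ltry.
Qed.

Lemma open_measure_gt0 (U : set (R * R)) : open U -> U !=set0 -> (0 < leb2 R U)%E.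
Proof.
move=> oU [[x y] Uxy].
have [e /= e0 be] := (nbhs_ballP _ _).1 (open_nbhs_nbhs (conj oU Uxy)).
apply: (@lt_le_trans _ _ (leb2 R (`]x - e, x + e[ `*` `]y - e, y + e[))).
  by rewrite box_measure ?lte_fin ?mulr_gt0 //; lra.
apply: le_measure; rewrite ?inE.
- by apply: measurableX; exact: measurable_itv.
- exact: open_measurable_plane.
move=> [u v] [/=]; rewrite !in_itv /= => uq vq.
by apply: be; split; rewrite /ball /= distrC ltr_distl.
Qed.

Lemma continuous_measurable_plane (D : set (R * R)) (f : R * R -> R) : open D ->
  {in D, continuous f} -> measurable_fun (D : set (plane R)) (f : plane R -> R).
Proof.
move=> oD cf; apply: (measurability _ (measurable_realfun.RGenOpens.measurableE R)).
move=> _ [_ [a [b ->] <-]]; apply: open_measurable_plane.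
rewrite openE => x [Dx fx]; apply: filterI; first exact: open_nbhs_nbhs.
apply: (cf x (mem_set Dx)); apply: open_nbhs_nbhs; split => //.
Qed.

End PlaneMeasure.

(** * Measurability of step functions *)

Section FiniteCover.
Context d (T : measurableType d) (R : realType).

(** Meant for gradients of piecewise linear functions, which are constant on each open cell. A
    preimage is the union of some of the [A i], possibly together with the complement of all of
    them. *)
Lemma measurable_fun_step (I : finType) (A : I -> set T) (f : T -> R) (c : R) :
  (forall i, measurable (A i)) ->
  (forall i x y, A i x -> A i y -> f x = f y) ->
  (forall x, (forall i, ~ A i x) -> f x = c) ->
  measurable_fun setT f.
Proof.
move=> mA Af fc _ Y mY; rewrite setTI.
pose B i := if `[< exists2 x, A i x & Y (f x) >] then A i else set0.
have mB i : measurable (B i) by rewrite /B; case: ifP.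
pose C := if `[< Y c >] then ~` (\bigcup_i A i) else set0.
have mC : measurable C.
  rewrite /C; case: ifP => // _; apply: measurableC.
  exact: countable_bigcupT_measurable.
suff -> : f @^-1` Y = (\bigcup_i B i) `|` C.
  by apply: measurableU => //; exact: countable_bigcupT_measurable.
apply/seteqP; split => [x /= Yx|x /= [[i _]|]].
- have [[i Ai]|nA] := pselect (exists i, A i x).
    by left; exists i => //; rewrite /B ifT //; apply/asboolP; exists x.
  right; rewrite /C ifT; first by move=> [i _ Ai]; apply: nA; exists i.
  by apply/asboolP; rewrite -(fc x) // => i Ai; apply: nA; exists i.
- by rewrite /B; case: asboolP => // -[y Ay Yy] Ax; rewrite (Af i x y).
- rewrite /C; case: asboolP => // Yc nA.
  by rewrite fc // => i Ai; apply: nA; exists i.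
Qed.

End FiniteCover.

(** * Integrability on a domain of finite measure *)

Section FiniteDomain.
Context d (T : measurableType d) (R : realType) (m : {measure set T -> \bar R}).
Variable D : set T.
Hypotheses (mD : measurable D) (finD : (m D < +oo)%E).
Implicit Types f g h : T -> R.
Local Notation intD f := (m.-integrable D (EFin \o f)).

(** The class of hat functions and of components of their gradients: the factors that preserve
    integrability. *)
Definition bounded_measurable f : Prop :=
  measurable_fun D f /\ exists C : R, forall x, D x -> `|f x| <= C.

Lemma bounded_measurableM f g : bounded_measurable f -> bounded_measurable g ->
  bounded_measurable (fun x => f x * g x).
Proof.
move=> [mf [C fC]] [mg [K gK]]; split; first exact: measurable_funM.
by exists (C * K) => x Dx; rewrite normrM ler_pM // ?fC ?gK.
Qed.

Lemma bounded_on f (C : R) : (forall x, D x -> `|f x| <= C) -> [bounded f x | x in D].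
Proof.
move=> fC; exists C; split; first exact: num_real.
by move=> y Cy x Dx; apply: le_trans (fC x Dx) _; exact: ltW.
Qed.

Lemma bounded_measurable_integrable f : bounded_measurable f -> intD f.
Proof.
move=> [mf [C fC]]; apply: measurable_bounded_integrable => //.
exact: bounded_on fC.
Qed.

Lemma integrable_mul f g : intD f -> bounded_measurable g ->
  intD (fun x => f x * g x).
Proof.
move=> intf [mg [C gC]].
exact: (integrableMl mD intf mg (bounded_on gC)).
Qed.

Lemma integrableD_EFin f g : intD f -> intD g -> intD (fun x => f x + g x).
Proof. by move=> intf intg; exact: (integrableD mD intf intg). Qed.

Lemma Lp_on_measurable p f : Lp_on m p D f -> measurable_fun D f.
Proof.
rewrite /Lp_on inE => /andP[/[!inE] /= mf _].
have := measurable_funS measurableT (subsetT D) mf.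
apply: eq_measurable_fun => x Dx.
by rewrite /= indicE Dx mulr1.
Qed.

(** The constant 1 is integrable on a domain of finite measure, and [|f| <= 1 + f ^+ 2]. *)
Lemma L2_on_integrable f : L2_on m D f -> intD f.
Proof.
move=> f2; have mf := Lp_on_measurable f2.
have := Lfun2_integrable_sqr f2 => /(integrableS measurableT mD (@subsetT _ _)) intf2.
have int1 : intD (fun=> 1).
  apply: bounded_measurable_integrable; split => //.
  by exists 1 => x _; rewrite normr1.
apply: (le_integrable mD _ _ (integrableD_EFin int1 intf2)).
  exact/measurable_EFinP.
move=> x Dx; rewrite /= lee_fin indicE mem_set // mulr1.
rewrite [leRHS]ger0_norm ?addr_ge0 ?sqr_ge0 //.
have := sqr_ge0 (`|f x| - 1); rewrite sqrrB1 -normrX ger0_norm ?sqr_ge0 //.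
have := normr_ge0 (f x); rewrite expr2; nra.
Qed.

Lemma Loo_on_integrable f : Lp_on m +oo%E D f -> intD f.
Proof.
move=> foo; have mf := Lp_on_measurable foo.
have [C fC] : exists C : R, {ae m, forall x, D x -> `|f x| <= C}.
  move: foo; rewrite /Lp_on inE => /andP[_ /[!inE] /=].
  rewrite /finite_norm unlock; case: ifPn => [_|m0 _]; last first.
    (* If the whole space is null, the L^oo norm is 0 by convention and not an essential supremum;
       then any bound holds almost everywhere. *)
    exists 0; exists setT; split => //.
    by apply/eqP; rewrite eq_le measure_ge0 andbT leNgt.
  set s := ess_sup _ _ => soo.
  have [C sC] : exists C : R, (s <= C%:E)%E.
    by move: soo; case: s => // [r _|_]; [exists r|exists 0; rewrite leNye].
  exists C; have /ess_supP := sC.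
  apply: filterS => x /=; rewrite lee_fin => + Dx.
  by rewrite indicE mem_set // mulr1.
apply/integrableP; split; first exact/measurable_EFinP.
apply: (@le_lt_trans _ _ (\int[m]_(x in D) `|C|%:E)%E).
  apply: ae_ge0_le_integral => //.
  - by apply: measurableT_comp => //; exact/measurable_EFinP.
  - apply: filterS fC => x fC Dx; rewrite lee_fin; apply: le_trans (fC Dx) _.
    exact: ler_norm.
by rewrite integral_cst // lte_mul_pinfty.
Qed.

Lemma bounded_measurable_cst c : bounded_measurable (fun=> c).
Proof. by split => //; exists `|c|. Qed.

Lemma integrableZ_EFin c f : intD f -> intD (fun x => c * f x).
Proof. by move=> intf; exact: (integrableZl mD c intf). Qed.

Lemma integrable_sum_EFin (I : Type) (s : seq I) (f : I -> T -> R) :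
  (forall i, intD (f i)) -> intD (fun x => \sum_(i <- s) f i x).
Proof.
move=> intf; elim: s => [|i s IH].
  under eq_fun do rewrite big_nil.
  by apply: bounded_measurable_integrable; exact: bounded_measurable_cst.
by under eq_fun do rewrite big_cons; exact: integrableD_EFin.
Qed.

Lemma Rintegral_sum (I : Type) (s : seq I) (f : I -> T -> R) :
  (forall i, intD (f i)) ->
  \int[m]_(x in D) \sum_(i <- s) f i x = \sum_(i <- s) \int[m]_(x in D) f i x.
Proof.
move=> intf; elim: s => [|i s IH].
  rewrite big_nil; under eq_Rintegral do rewrite big_nil.
  by rewrite Rintegral_cst // mul0r.
rewrite big_cons -IH; under eq_Rintegral do rewrite big_cons.
by rewrite RintegralD //; exact: integrable_sum_EFin.
Qed.

Lemma Rintegral_eq0 f : (forall x, D x -> f x = 0) -> \int[m]_(x in D) f x = 0.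
Proof.
move=> f0; rewrite (@eq_Rintegral _ _ _ m D (fun=> 0)) => [|x /set_mem]; last exact: f0.
by rewrite Rintegral_cst // mul0r.
Qed.

(** Replacing [f] by [- max 0 (- f)] changes it only on a null set and makes the sign hold
    everywhere. An infinite integral does no harm, since [fine] sends it to 0. *)
Lemma Rintegral_ae_le0 f : measurable_fun D f ->
  {ae m, forall x, D x -> f x <= 0} -> \int[m]_(x in D) f x <= 0.
Proof.
move=> mf f0; pose g x := Num.max 0 (- f x).
have mg : measurable_fun D g.
  by apply: measurable_maxr => //; exact: measurableT_comp.
rewrite /Rintegral (@ae_eq_integral _ _ _ m D (fun x => - (g x)%:E)%E) //; last first.
- apply: filterS f0 => x f0 Dx; rewrite -EFinN /g; congr EFin.
  by rewrite max_r ?oppr_ge0 ?f0 // opprK.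
- by apply: measurableT_comp => //; exact/measurable_EFinP.
- exact/measurable_EFinP.
rewrite integral_ge0N => [|x _]; last by rewrite lee_fin le_max lexx.
rewrite fineN oppr_le0; apply: fine_ge0; apply: integral_ge0 => x _.
by rewrite lee_fin le_max lexx.
Qed.

Lemma Rintegral_mul_ae_le0 f g : intD f -> bounded_measurable g ->
  (forall x, D x -> 0 <= g x) -> {ae m, forall x, D x -> f x <= 0} ->
  \int[m]_(x in D) (f x * g x) <= 0.
Proof.
move=> intf bg g0 f0; apply: Rintegral_ae_le0.
  by apply/measurable_EFinP; have /integrableP[] := integrable_mul intf bg.
by apply: filterS f0 => x fx Dx; rewrite mulr_le0_ge0 ?fx ?g0.
Qed.

Lemma Rintegral_mul_ae_ge0 f g : intD f -> bounded_measurable g ->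
  (forall x, D x -> 0 <= g x) -> {ae m, forall x, D x -> 0 <= f x} ->
  0 <= \int[m]_(x in D) (f x * g x).
Proof.
move=> intf bg g0 f0; rewrite -oppr_le0 -mulN1r -RintegralZl //; last first.
  exact: integrable_mul.
under eq_Rintegral do rewrite mulN1r -mulNr.
apply: Rintegral_mul_ae_le0 => //.
  exact: (integrableN intf).
by apply: filterS f0 => x fx Dx; rewrite oppr_le0 fx.
Qed.

End FiniteDomain.

(** * Limited fluxes at extrema *)

Section CorrectionFactors.
Context {R : realType} (Omega : set (R * R)) (M : mesh R).
Local Notation N := (nlast M).+1.
Implicit Types (c K : 'M[R]_N) (psi zeta x y r : 'cV[R]_N) (i j : 'I_N).

(** Common form of the three corrections [fbar], [fhbar] and [gbar], so that extrema are analysed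
    once. *)
Definition flux c psi zeta : 'cV[R]_N :=
  \col_i \sum_(j | j != i)
    acorr Omega c psi zeta i j * (c i j * (psi i 0 - psi j 0)).

(** The support condition reconciles the sum over all [j != i] in [flux] with [Pplus] and [Pminus],
    which see only neighbours. *)
Definition weights c : Prop :=
  forall i j, j != i -> 0 <= c i j /\ (~~ neighbor i j -> c i j = 0).

Lemma dist_to_ge0 (z : R * R) (A : set (R * R)) : 0 <= dist_to z A.
Proof.
rewrite /dist_to; case: (pselect (A !=set0)) => [[y Ay]|A0].
  apply: lb_le_inf; first by exists (enorm (z - y)); exists y.
  by move=> _ [u _ <-]; exact: sqrtr_ge0.
have -> : A = set0 by apply/seteqP; split => // y Ay; case: A0; exists y.
by rewrite image_set0 inf0.
Qed.

(** The sign of [gamma] makes all correction factors nonnegative; at a maximum its size is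
    multiplied by 0. *)
Lemma gamma_ge0 i : 0 <= gamma i.
Proof.
apply: divr_ge0; last exact: dist_to_ge0.
elim/big_ind: _ => // [u v u0 v0|j _]; first by rewrite le_max u0.
exact: sqrtr_ge0.
Qed.

Lemma neighbor_neq i j : neighbor i j -> j != i.
Proof. by case/andP. Qed.

Lemma qcoef_ge0 c i : weights c -> 0 <= qcoef c i.
Proof.
move=> wc; apply: mulr_ge0; first exact: gamma_ge0.
by apply: sumr_ge0 => j /neighbor_neq ij; case: (wc i j ij).
Qed.

(** The hypothesis on the product covers both the nonnegative pair [Qplus], [Pplus] and the
    nonpositive pair [Qminus], [Pminus]. *)
Lemma Rfactor_ge0 (Q P : R) : 0 <= Q * P -> 0 <= Rfactor Q P.
Proof.
rewrite /Rfactor; case: eqP => [_ _|/eqP P0 QP]; first exact: ler01.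
have -> : Q / P = Q * P / P ^+ 2 by field.
by rewrite le_min ler01 divr_ge0 // sqr_ge0.
Qed.

Lemma Rfactor_opp (Q P : R) : Rfactor (- Q) (- P) = Rfactor Q P.
Proof. by rewrite /Rfactor oppr_eq0 invrN mulrNN. Qed.

Lemma Pplus_ge0 c psi i : 0 <= Pplus c psi i.
Proof. by apply: sumr_ge0 => j _; rewrite le_max lexx. Qed.

Lemma Pminus_le0 c psi i : Pminus c psi i <= 0.
Proof. by apply: sumr_le0 => j _; rewrite ge_min lexx. Qed.

Lemma Qplus_ge0 c zeta i : weights c -> 0 <= Qplus c zeta i.
Proof.
move=> wc; apply: mulr_ge0; first exact: qcoef_ge0.
by rewrite subr_ge0; exact: bigmax_ge_id.
Qed.

Lemma Qminus_le0 c zeta i : weights c -> Qminus c zeta i <= 0.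
Proof.
move=> wc; rewrite /Qminus mulr_ge0_le0 //; first exact: qcoef_ge0.
by rewrite subr_le0; exact: bigmin_le_id.
Qed.

Lemma abar_ge0 c psi zeta i j : weights c -> 0 <= abar Omega c psi zeta i j.
Proof.
move=> wc; rewrite /abar; case: ifP => _; first exact: ler01.
case: ifP => _; first by rewrite Rfactor_ge0 // mulr_ge0 ?Qplus_ge0 ?Pplus_ge0.
case: ifP => _ //; rewrite Rfactor_ge0 // mulr_le0 ?Qminus_le0 ?Pminus_le0 //.
Qed.

(* At a maximum of [zeta] the positive fluxes into the node are cancelled, since
   [Qplus] vanishes. *)
Lemma flux_le0 c psi zeta i :
  weights c -> interior_node Omega i -> (forall j, zeta j 0 <= zeta i 0) ->
  flux c psi zeta i 0 <= 0.
Proof.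
move=> wc Ii maxi; rewrite mxE; apply: sumr_le0 => j ij.
have [s0|s0] := ltP 0 (c i j * (psi i 0 - psi j 0)); last first.
  by rewrite mulr_ge0_le0 // le_min !abar_ge0.
suff -> : acorr Omega c psi zeta i j = 0 by rewrite mul0r.
(* A positive flux has a nonzero weight, so it is one of the terms of [Pplus]. Hence [Pplus] is
   positive and the convention R = 1 for vanishing P does not apply. *)
have nij : neighbor i j.
  apply: contraTT s0 => /(proj2 (wc i j ij)) ->.
  by rewrite mul0r ltxx.
rewrite /acorr /abar Ii /= s0.
have -> : Qplus c zeta i = 0.
  apply/eqP; rewrite mulf_eq0 subr_eq0; apply/orP; right.
  by rewrite eq_le bigmax_ge_id andbT; apply/bigmax_leP; split.
have P0 : 0 < Pplus c psi i.
  rewrite /Pplus (bigD1 j) //= ltr_pwDl //; first by rewrite lt_max s0 orbT.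
  by apply: sumr_ge0 => l _; rewrite le_max lexx.
rewrite {1}/Rfactor gt_eqF // mul0r.
rewrite (min_idPr ler01) -/(abar Omega c psi zeta j i).
by apply/min_idPl; exact: abar_ge0.
Qed.

Lemma Pplus_opp c psi i : Pplus c (- psi) i = - Pminus c psi i.
Proof.
rewrite /Pplus /Pminus -sumrN; apply: eq_bigr => j _.
by rewrite !mxE -opprD mulrN -{1}oppr0 -oppr_min.
Qed.

Lemma bigmax_opp (I : finType) (P : pred I) (z : R) (f : I -> R) :
  \big[Num.max/- z]_(j | P j) - f j = - \big[Num.min/z]_(j | P j) f j.
Proof. by apply/esym/(big_morph (fun t : R => - t)) => // u v; exact: oppr_min. Qed.

Lemma Qplus_opp c zeta i : Qplus c (- zeta) i = - Qminus c zeta i.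
Proof.
rewrite /Qplus /Qminus -mulrN mxE opprB; congr (_ * _).
rewrite -bigmax_opp opprK addrC; congr (_ + _).
by apply: eq_bigr => j _; rewrite mxE.
Qed.

Lemma Pminus_opp c psi i : Pminus c (- psi) i = - Pplus c psi i.
Proof. by rewrite -[in RHS](opprK psi) Pplus_opp opprK. Qed.

Lemma Qminus_opp c zeta i : Qminus c (- zeta) i = - Qplus c zeta i.
Proof. by rewrite -[in RHS](opprK zeta) Qplus_opp opprK. Qed.

(** The sign change reverses the test on the flux and exchanges the plus and minus quantities up to
    sign; their quotient is unaffected by a common sign. *)
Lemma abar_opp c psi zeta i j :
  abar Omega c (- psi) (- zeta) i j = abar Omega c psi zeta i j.
Proof.
rewrite /abar !mxE -opprD mulrN oppr_gt0 oppr_lt0.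
rewrite Qplus_opp Pplus_opp Qminus_opp Pminus_opp !Rfactor_opp.
by case: ifP => // _; case: ltgtP.
Qed.

Lemma flux_opp c psi zeta : flux c (- psi) (- zeta) = - flux c psi zeta.
Proof.
apply/colP => i; rewrite !mxE -sumrN; apply: eq_bigr => j _.
by rewrite /acorr !abar_opp !mxE -opprD !mulrN.
Qed.

Lemma fbar_flux c x : (forall i j, j != i -> c i j <= 0) ->
  fbar Omega c x = flux (map_mx Num.norm c) x x.
Proof.
move=> c0; apply/colP => i; rewrite !mxE; apply: eq_bigr => j ij.
by rewrite mxE ler0_norm ?c0 // mulNr -mulrN opprB.
Qed.

Lemma fhbar_flux c x : fhbar Omega c x = flux c x x.
Proof. by []. Qed.

Lemma gbar_flux c x y : gbar Omega c x y = flux c (x - y) x.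
Proof.
by apply/colP => i; rewrite !mxE; apply: eq_bigr => j _; rewrite !mxE.
Qed.

Lemma le_vmax (y : 'cV[R]_N) i : y i 0 <= vmax y.
Proof. exact: (@le_bigmax _ _ _ (y ord0 0) (fun i => y i 0)). Qed.

Lemma vmax_opp (y : 'cV[R]_N) : vmax (- y) = - vmin y.
Proof.
rewrite /vmax /vmin -bigmax_opp mxE.
by apply: eq_bigr => j _; rewrite mxE.
Qed.

(** As the row sums to 0, [x i 0] may be subtracted from every entry of [x]. The diagonal term then
    vanishes and each other term is a product of two nonpositive numbers. *)
Lemma zero_sum_max_ge0 K x i :
  (forall j, j != i -> K i j <= 0) -> \sum_j K i j = 0 ->
  (forall j, x j 0 <= x i 0) -> 0 <= (K *m x) i 0.
Proof.
move=> K0 sK maxi; rewrite mxE.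
have -> : \sum_j K i j * x j 0 = \sum_j K i j * (x j 0 - x i 0).
  under [RHS]eq_bigr do rewrite mulrBr.
  by rewrite sumrB -mulr_suml sK mul0r subr0.
apply: sumr_ge0 => j _; have [->|ij] := eqVneq j i.
  by rewrite subrr mulr0.
by rewrite mulr_le0 ?K0 // subr_le0.
Qed.

(** * Maximum principle for one abstract time step *)

Section Step.
Variables (K c mass : 'M[R]_N) (m : 'rV[R]_N) (k sig : R).
Hypotheses (k0 : 0 <= k) (sig0 : 0 <= sig)
  (m0 : forall i, interior_node Omega i -> 0 < m 0 i).
Hypotheses (K0 : forall i j, j != i -> K i j <= 0)
  (sK : forall i, \sum_j K i j = 0).
Hypotheses (wc : weights c) (wmass : weights mass).
Hypothesis bd : exists i0 : 'I_N, ~~ interior_node Omega i0.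

(** Here [x] is the unknown level and [y] the known one: n and n-1 for the state, n-1 and n for the
    adjoint. [K] gathers diffusion, convection and artificial diffusion, apart from the reaction
    term. *)
Definition afc_step x y r : Prop := forall i, interior_node Omega i ->
  ((diag_mx m + k *: (K + sig *: diag_mx m)) *m x) i 0 =
  (diag_mx m *m y + k *: r + k *: flux c x x + flux mass (x - y) x) i 0.

(* A maximum of [x] at a boundary node is 0, which is at most [vmax y] because
   [y] also vanishes there; at an interior maximum the equation gives
   [(1 + k sig) x_i <= y_i]. *)
Lemma afc_step_max x y r :
  (forall i, ~~ interior_node Omega i -> x i 0 = 0 /\ y i 0 = 0) ->
  (forall i, interior_node Omega i -> r i 0 <= 0) ->
  afc_step x y r -> forall i, x i 0 <= vmax y.
Proof.
move=> xy0 r0 eqn.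
have vy0 : 0 <= vmax y.
  by have [i0 /xy0[_ <-]] := bd; exact: le_vmax.
have [i _ maxi] := @arg_maxP _ _ _ (ord0 : 'I_N) predT (fun i => x i 0) isT.
move=> l; apply: (@le_trans _ _ (x i 0)); first exact: maxi.
have {}maxi j : x j 0 <= x i 0 by exact: maxi.
case: (boolP (interior_node Omega i)) => [Ii|/xy0[-> _] //].
have := eqn i Ii.
have Kx := zero_sum_max_ge0 (K0 (i := i)) (sK i) maxi.
have f1 := flux_le0 x wc Ii maxi.
have f2 := flux_le0 (x - y) wmass Ii maxi.
have -> : (diag_mx m + k *: (K + sig *: diag_mx m)) *m x =
  diag_mx m *m x + k *: (K *m x + sig *: (diag_mx m *m x)).
  by rewrite mulmxDl -scalemxAl mulmxDl -scalemxAl.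
have dE (z : 'cV[R]_N) : (diag_mx m *m z) i 0 = m 0 i * z i 0.
  by rewrite mul_diag_mx mxE.
move: (flux c x x) (flux mass (x - y) x) f1 f2 (r0 _ Ii) => F1 F2 f1 f2 ri.
rewrite !mxE in Kx |- *.
have := dE x; have := dE y; rewrite !mxE => -> -> {}eqn.
(* If [x i 0] exceeded [vmax y], it would be positive, so the reaction term would be nonnegative.
   All terms then have signs that contradict [m 0 i * y i 0 < m 0 i * x i 0]. *)
rewrite leNgt; apply/negP => lt.
have yi := le_vmax y i.
have mi := m0 Ii.
have x0 : 0 < x i 0 by lra.
have h1 : 0 <= k * (sig * (m 0 i * x i 0)) by rewrite !mulr_ge0 // ltW.
have h2 : k * r i 0 <= 0 by rewrite mulr_ge0_le0.
have h3 : k * F1 i 0 <= 0 by rewrite mulr_ge0_le0.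
have h4 := mulr_ge0 k0 Kx.
have h5 : m 0 i * y i 0 < m 0 i * x i 0 by rewrite ltr_pM2l //; lra.
rewrite mulrDr in eqn; lra.
Qed.

Lemma afc_step_min x y r :
  (forall i, ~~ interior_node Omega i -> x i 0 = 0 /\ y i 0 = 0) ->
  (forall i, interior_node Omega i -> 0 <= r i 0) ->
  afc_step x y r -> forall i, vmin y <= x i 0.
Proof.
move=> xy0 r0 eqn i; rewrite -lerN2 -vmax_opp.
have -> : - x i 0 = (- x) i 0 by rewrite mxE.
apply: (@afc_step_max _ _ (- r)).
- by move=> j /xy0[xj yj]; rewrite !mxE xj yj oppr0.
- by move=> j /r0; rewrite mxE oppr_le0.
- move=> j /eqn e.
  rewrite -[- x - - y]opprD !mulmxN !flux_opp !scalerN -!opprD [LHS]mxE e.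
  by rewrite [RHS]mxE.
Qed.

End Step.
End CorrectionFactors.

(** * Piecewise linear functions on a triangulation *)

Section Affine.
Context {R : realType}.
Implicit Types (A : set (R * R)) (a x v : R * R) (c : R).

Lemma dotC (u v : R * R) : dot u v = dot v u.
Proof. by rewrite /dot mulrC [X in _ + X]mulrC. Qed.

Lemma dot0l (u : R * R) : dot 0 u = 0.
Proof. by rewrite /dot !mul0r addr0. Qed.

Lemma dotDr (u v w : R * R) : dot u (v + w) = dot u v + dot u w.
Proof.
rewrite /dot (_ : (v + w).1 = v.1 + w.1) // (_ : (v + w).2 = v.2 + w.2) //.
by ring.
Qed.

Lemma dotZr (k : R) (u v : R * R) : dot u (k *: v) = k * dot u v.
Proof.
rewrite /dot (_ : (k *: v).1 = k * v.1) // (_ : (k *: v).2 = k * v.2) //.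
by ring.
Qed.

Lemma dotDl (u v w : R * R) : dot (v + w) u = dot v u + dot w u.
Proof. by rewrite dotC dotDr ![dot u _]dotC. Qed.

Lemma dotZl (k : R) (u v : R * R) : dot (k *: v) u = k * dot v u.
Proof. by rewrite dotC dotZr dotC. Qed.

Lemma sub_conv_hull A : A `<=` conv_hull A.
Proof. exact: sub_gen_smallest. Qed.

(** A half-plane is convex, and the hull is the smallest convex set containing [A]. *)
Lemma affine_ge0_conv_hull A a c : (forall x, A x -> 0 <= dot a x + c) ->
  forall x, conv_hull A x -> 0 <= dot a x + c.
Proof.
move=> h; apply: (smallest_sub (X := [set x | 0 <= dot a x + c])) => //.
move=> x y l /set_mem /= hx /set_mem /= hy; apply/mem_set => /=.
have -> : dot a (conv l x y) + c = l%:num * (dot a x + c) + (1 - l%:num) * (dot a y + c).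
  rewrite (_ : conv l x y = l%:num *: x + (1 - l%:num) *: y) //.
  by rewrite dotDr !dotZr; ring.
have l0 : 0 <= l%:num by [].
have l1 : l%:num <= 1 by [].
by rewrite addr_ge0 // mulr_ge0 // subr_ge0.
Qed.

Lemma is_derive_affine a c x v (f : R * R -> R) :
  (\forall y \near x, f y = dot a y + c) -> 'D_v f x = dot a v.
Proof.
move=> fE; rewrite (near_eq_derive _ fE) /derive.
apply: cvg_lim => //; apply: cvg_near_cst.
near=> h; rewrite /=.
have h0 : h != 0 by near: h; exact: nbhs_dnbhs_neq.
rewrite dotDr dotZr (_ : _ - _ = h * dot a v); last by ring.
by rewrite /GRing.scale /= mulrA mulVf // mul1r.
Unshelve. all: by end_near. Qed.

Lemma grad_affine a c x (f : R * R -> R) :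
  (\forall y \near x, f y = dot a y + c) -> grad f x = a.
Proof.
move=> fE; rewrite /grad !(is_derive_affine _ fE) /dot /=.
by rewrite !mulr1 !mulr0 addr0 add0r; case: a {fE}.
Qed.

Lemma enorm2 x : enorm x ^+ 2 = dot x x.
Proof. by rewrite sqr_sqrtr // /dot -!expr2 addr_ge0 // sqr_ge0. Qed.

Lemma dot_le_enorm (u v : R * R) : `|dot u v| <= enorm u * enorm v.
Proof.
rewrite -(ler_pXn2r (n := 2)) ?nnegrE ?mulr_ge0 ?sqrtr_ge0 ?normr_ge0 //.
rewrite exprMn !enorm2 -normrX ger0_norm ?sqr_ge0 // /dot.
(* Lagrange's identity: this square is the defect in the Cauchy-Schwarz inequality. *)
have := sqr_ge0 (u.1 * v.2 - u.2 * v.1); nra.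
Qed.

(** Cauchy-Schwarz puts the quotient in [-1, 1], where [cos] inverts [acos], and the cosine is
    positive below pi / 2. A degenerate edge would make the quotient 0, against its positivity. *)
Lemma acute_angle_dot_gt0 (a b c : R * R) : angle a b c < pi / 2 ->
  0 < dot (b - a) (c - a).
Proof.
rewrite /angle; set u := b - a; set v := c - a; set e := enorm u * enorm v.
move=> ac; have e0 : 0 <= e by rewrite mulr_ge0 ?sqrtr_ge0.
have := dot_le_enorm u v; rewrite -/e => le_e.
have q1 : -1 <= dot u v / e <= 1.
  have [->|ne] := eqVneq e 0; first by rewrite invr0 mulr0 lerN10 ler01.
  have {}e0 : 0 < e by rewrite lt_neqAle eq_sym ne.
  by rewrite ler_pdivlMr // ler_pdivrMr // mulN1r mul1r -ler_norml.
have : 0 < dot u v / e.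
  have [a0 <-] := acos_def q1; apply: cos_gt0_pihalf; rewrite ac andbT.
  by have := pi_gt0 R; have := acos_ge0 q1; lra.
have [->|ne] := eqVneq e 0; first by rewrite invr0 mulr0 ltxx.
by rewrite pmulr_lgt0 // invr_gt0 lt_neqAle eq_sym ne.
Qed.

(* [a] and [b] are the gradients of two barycentric coordinates of a triangle
   with edge vectors [e] and [f]: with [det = e.1 * f.2 - e.2 * f.1] one has
   [dot a b * det ^+ 2 = - dot e f]. *)
Lemma dual_basis_dot_le0 (a b e f : R * R) :
  dot a e = 1 -> dot a f = 0 -> dot b e = 0 -> dot b f = 1 ->
  0 <= dot e f -> dot a b <= 0.
Proof.
rewrite /dot => ae af be bf ef.
set det := e.1 * f.2 - e.2 * f.1.
(* Cramer's rule for the components of [a] and [b], as linear combinations of the duality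
   relations. *)
have a1 : a.1 * det = f.2.
  transitivity (f.2 * (a.1 * e.1 + a.2 * e.2) - e.2 * (a.1 * f.1 + a.2 * f.2)).
    by rewrite /det; ring.
  by rewrite ae af mulr0 subr0 mulr1.
have a2 : a.2 * det = - f.1.
  transitivity (e.1 * (a.1 * f.1 + a.2 * f.2) - f.1 * (a.1 * e.1 + a.2 * e.2)).
    by rewrite /det; ring.
  by rewrite ae af mulr0 sub0r mulr1.
have b1 : b.1 * det = - e.2.
  transitivity (f.2 * (b.1 * e.1 + b.2 * e.2) - e.2 * (b.1 * f.1 + b.2 * f.2)).
    by rewrite /det; ring.
  by rewrite be bf mulr0 sub0r mulr1.
have b2 : b.2 * det = e.1.
  transitivity (e.1 * (b.1 * f.1 + b.2 * f.2) - f.1 * (b.1 * e.1 + b.2 * e.2)).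
    by rewrite /det; ring.
  by rewrite be bf mulr0 subr0 mulr1.
have h : (a.1 * b.1 + a.2 * b.2) * det ^+ 2 = - (e.1 * f.1 + e.2 * f.2).
  transitivity ((a.1 * det) * (b.1 * det) + (a.2 * det) * (b.2 * det)).
    by ring.
  by rewrite a1 a2 b1 b2; ring.
(* A zero determinant would force [e] to vanish, against [dot a e = 1]. *)
have [d0|d0] := eqVneq det 0.
  move: b1 b2 ae; rewrite d0 !mulr0 => /esym/eqP; rewrite oppr_eq0 => /eqP -> <-.
  by lra.
have d2 : 0 < det ^+ 2 by rewrite exprn_even_gt0.
rewrite -(pmulr_lle0 _ d2) h; lra.
Qed.

End Affine.

(** * Cellwise affine functions and the nodal basis *)

Section PiecewiseLinear.
Context {R : realType} (Omega : set (R * R)) (M : mesh R).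
Local Notation N := (nlast M).+1.
Implicit Types (v w : R * R -> R) (t : {set 'I_N}).

Definition cellwise_affine v : Prop := forall t, t \in tri M ->
  exists (a : R * R) (c : R), forall x, cell t x -> v x = dot a x + c.

Lemma cellwise_affineD v w : cellwise_affine v -> cellwise_affine w ->
  cellwise_affine (fun x => v x + w x).
Proof.
move=> av aw t tM; have [a [c vE]] := av t tM; have [b [d wE]] := aw t tM.
exists (a + b), (c + d) => x tx; rewrite vE // wE // dotDl; ring.
Qed.

Lemma cellwise_affineZ k v : cellwise_affine v ->
  cellwise_affine (fun x => k * v x).
Proof.
move=> av t tM; have [a [c vE]] := av t tM.
exists (k *: a), (k * c) => x tx; rewrite vE // dotZl; ring.
Qed.

Lemma cellwise_affine_cst k : cellwise_affine (fun=> k).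
Proof. by move=> t _; exists 0, k => x _; rewrite dot0l add0r. Qed.

Lemma cellwise_affine_sum (I : Type) (s : seq I) (f : I -> R * R -> R) :
  (forall i, cellwise_affine (f i)) ->
  cellwise_affine (fun x => \sum_(i <- s) f i x).
Proof.
move=> af; elim: s => [|i s IH].
  by under eq_fun do rewrite big_nil; exact: cellwise_affine_cst.
by under eq_fun do rewrite big_cons; exact: cellwise_affineD.
Qed.

Lemma node_cell t i : i \in t -> cell t (node M i).
Proof. by move=> it; apply: sub_conv_hull; exists i. Qed.

Lemma cellwise_affine_ge0 v t : cellwise_affine v -> t \in tri M ->
  (forall i, i \in t -> 0 <= v (node M i)) -> forall x, cell t x -> 0 <= v x.
Proof.
move=> av tM v0 x tx; have [a [c vE]] := av t tM.
rewrite vE //; move: x tx; apply: affine_ge0_conv_hull => _ [i it <-].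
by rewrite -vE ?v0 //; exact: node_cell.
Qed.

(** Uniqueness of linear interpolation, from the signs of the two differences on the hull of the
    vertices. *)
Lemma cellwise_affine_eq v w t :
  cellwise_affine v -> cellwise_affine w -> t \in tri M ->
  (forall i, i \in t -> v (node M i) = w (node M i)) ->
  forall x, cell t x -> v x = w x.
Proof.
move=> av aw tM vw x tx; apply/eqP; rewrite eq_le -subr_ge0 -[X in _ && X]subr_ge0.
have sub v' w' : cellwise_affine v' -> cellwise_affine w' ->
    (forall i, i \in t -> v' (node M i) = w' (node M i)) -> 0 <= w' x - v' x.
  move=> av' aw' vw'.
  have := cellwise_affineD aw' (cellwise_affineZ (-1) av').
  move=> /cellwise_affine_ge0 /(_ tM) h.
  rewrite -mulN1r; apply: h tx => i it.
  by rewrite vw' // mulN1r subrr.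
by rewrite !sub // => i it; rewrite vw.
Qed.

Hypothesis confM : conforming Omega M.

Lemma cell_cover x : closure Omega x -> exists2 t, t \in tri M & cell t x.
Proof. by case: confM => _ _ _ <- _ [t tM tx]; exists t. Qed.

Lemma cell_closure t x : t \in tri M -> cell t x -> closure Omega x.
Proof. by case: confM => _ _ _ <- _ tM tx; exists t. Qed.

(* A node with the largest first coordinate is extreme in the union of the
   triangles. *)
Lemma exists_boundary_node : open Omega -> exists i : 'I_N, ~~ interior_node Omega i.
Proof.
move=> oO; have [i _ maxi] :=
  @arg_maxP _ _ _ (ord0 : 'I_N) predT (fun i => (node M i).1) isT.
exists i; apply/negP => /asboolP Oi.
have [e /= e0 be] := (nbhs_ballP _ _).1 (open_nbhs_nbhs (conj oO Oi)).
have e2 : 0 < e / 2 by rewrite divr_gt0.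
(* This point to the right of the node is still in [Omega], hence in a cell; but all vertices, and
   so all cells, lie weakly to the left of the node. *)
pose x : R * R := ((node M i).1 + e / 2, (node M i).2).
have /be Ox : ball (node M i) e x.
  split; rewrite /ball /= ?subrr ?normr0 // opprD addrA subrr sub0r normrN.
  by rewrite gtr0_norm //; lra.
have [t tM tx] := cell_cover (subset_closure Ox).
have af : cellwise_affine (fun y : R * R => (node M i).1 - y.1).
  move=> s sM; exists (-1, 0), (node M i).1 => y _; rewrite /dot /=; ring.
suff : 0 <= (node M i).1 - x.1 by rewrite /x /=; lra.
apply: (cellwise_affine_ge0 af tM _ tx) => j _.
by rewrite subr_ge0; exact: maxi.
Qed.

Section Basis.
Variable phi : 'I_N -> R * R -> R.
Hypothesis phiB : nodal_basis Omega phi.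

Lemma basis_affine i : cellwise_affine (phi i).
Proof. by case: (phiB i) => -[]. Qed.

Lemma basis_node i j : phi i (node M j) = (i == j)%:R.
Proof. by case: (phiB i). Qed.

Lemma basis_ge0 i x : closure Omega x -> 0 <= phi i x.
Proof.
move=> /cell_cover[t tM tx]; apply: (cellwise_affine_ge0 (basis_affine i) tM _ tx).
by move=> j _; rewrite basis_node ler0n.
Qed.

Lemma interpolation v x : cellwise_affine v -> closure Omega x ->
  v x = \sum_j v (node M j) * phi j x.
Proof.
move=> av /cell_cover[t tM tx].
apply: (cellwise_affine_eq (w := fun y => \sum_j v (node M j) * phi j y)
  av _ tM _ tx) => [|i _].
  by apply: cellwise_affine_sum => j; apply: cellwise_affineZ; exact: basis_affine.
rewrite (bigD1 i) //= basis_node eqxx mulr1 big1 ?addr0 // => j /negPf ji.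
by rewrite basis_node ji mulr0.
Qed.

Lemma basis_sum1 x : closure Omega x -> \sum_j phi j x = 1.
Proof.
move=> /(interpolation (cellwise_affine_cst 1)) ->.
by apply: eq_bigr => j _; rewrite mul1r.
Qed.

Lemma basis_le1 i x : closure Omega x -> phi i x <= 1.
Proof.
move=> Ox; rewrite -(basis_sum1 Ox) (bigD1 i) //= lerDl.
by apply: sumr_ge0 => j _; exact: basis_ge0.
Qed.

Lemma basis_support i t x : t \in tri M -> cell t x -> i \notin t -> phi i x = 0.
Proof.
move=> tM tx it; apply: (cellwise_affine_eq (w := fun=> 0) (basis_affine i) _ tM _ tx).
  exact: cellwise_affine_cst.
by move=> j jt; rewrite basis_node; case: eqP it jt => // -> /negPf ->.
Qed.

Lemma neighborN i j t : ~~ neighbor i j -> j != i -> t \in tri M ->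
  i \notin t \/ j \notin t.
Proof.
rewrite /neighbor => nij ji tM; move: nij; rewrite ji /= => /existsPn /(_ t).
by rewrite tM /= negb_and => /orP.
Qed.

Lemma basis_mul0 i j x : closure Omega x -> ~~ neighbor i j -> j != i ->
  phi i x * phi j x = 0.
Proof.
move=> /cell_cover[t tM tx] nij ij.
case: (neighborN nij ij tM) => /(basis_support tM tx) ->.
  by rewrite mul0r.
by rewrite mulr0.
Qed.

Lemma pgrad_cell t : t \in tri M -> exists (g : 'I_N -> R * R) (c : 'I_N -> R),
  (forall i y, cell t y -> phi i y = dot (g i) y + c i) /\
  forall i x, interior (cell t) x -> pgrad M (phi i) x = g i.
Proof.
move=> tM; have h i : exists gc : (R * R) * R,
    forall y, cell t y -> phi i y = dot gc.1 y + gc.2.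
  by have [a [c E]] := basis_affine i tM; exists (a, c).
have [gc gcE] := choice h.
exists (fun i => (gc i).1), (fun i => (gc i).2); split => // i x tx.
rewrite /pgrad ifT; last by apply/asboolP; exists t.
apply: grad_affine; move: tx; apply: filterS => y; exact: gcE.
Qed.

Lemma pgrad_outside v x : ~ (exists2 t, t \in tri M & interior (cell t) x) ->
  pgrad M v x = 0.
Proof. by move=> /asboolPn /negPf; rewrite /pgrad => ->. Qed.

Lemma pgrad_support i t x : t \in tri M -> interior (cell t) x -> i \notin t ->
  pgrad M (phi i) x = 0.
Proof.
move=> tM tx it; rewrite /pgrad ifT; last by apply/asboolP; exists t.
apply: (@grad_affine _ 0 0); move: tx; apply: filterS => y ty.
by rewrite (basis_support tM ty it) dot0l addr0.
Qed.

(** Inside a cell the constant 1 is the sum of the hat functions, hence affine with the sum of their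
    gradients as slope; its gradient is also 0. Outside the open cells every term is 0 by the choice
    made in [pgrad]. *)
Lemma sum_pgrad x : \sum_j pgrad M (phi j) x = 0.
Proof.
have [[t tM tx]|nt] := pselect (exists2 t, t \in tri M & interior (cell t) x).
  have [g [c [gE dgE]]] := pgrad_cell tM.
  rewrite (eq_bigr (fun j => g j)) => [|j _]; last exact: dgE.
  rewrite -(@grad_affine _ (\sum_j g j) (\sum_j c j) x (fun=> 1)).
    apply: (@grad_affine _ 0 1); near=> y; by rewrite dot0l add0r.
  move: tx; apply: filterS => y ty.
  rewrite -(basis_sum1 (cell_closure tM ty)).
  rewrite (eq_bigr (fun j => dot (g j) y + c j)) => [|j _]; last exact: gE.
  rewrite big_split /=; congr (_ + _).
  elim/big_rec2: _ => [|j u v _ ->]; first by rewrite dot0l.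
  by rewrite dotDl.
by apply: big1 => j _; exact: pgrad_outside.
Unshelve. all: by end_near. Qed.

(** In a triangle with vertices i, j, l the two gradients are the basis dual to the edges from l,
    which meet at an acute angle. In any other triangle one of the gradients vanishes. *)
Lemma pgrad_dot_le0 i j x : acute M -> j != i ->
  dot (pgrad M (phi i) x) (pgrad M (phi j) x) <= 0.
Proof.
move=> acM ji.
have [[t tM tx]|nt] := pselect (exists2 t, t \in tri M & interior (cell t) x);
  last by rewrite pgrad_outside // dot0l.
have [it|nit] := boolP (i \in t); last first.
  by rewrite (pgrad_support tM tx nit) dot0l.
have [jt|njt] := boolP (j \in t); last first.
  by rewrite (pgrad_support tM tx njt) dotC dot0l.
have [l [lt li lj]] : exists l, [/\ l \in t, l != i & l != j].
  have c3 : #|t| = 3%N by case: confM => _ /(_ t tM)[].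
  have : (0 < #|t :\ i :\ j|)%N.
    have c2 := cardsD1 i t; have := cardsD1 j (t :\ i).
    rewrite c3 it in c2; rewrite !inE ji jt /=.
    by move: c2; rewrite /= !add1n => -[<-] [<-].
  by case/card_gt0P => l; rewrite !inE => /and3P[]; exists l.
have [g [c [gE dgE]]] := pgrad_cell tM.
rewrite !dgE //.
have val k n : n \in t -> dot (g k) (node M n) + c k = (k == n)%:R.
  by move=> nt; rewrite -gE ?basis_node //; exact: node_cell.
have dif k n : n \in t -> dot (g k) (node M n - node M l) = (k == n)%:R - (k == l)%:R.
  move=> nt; rewrite -(val k n nt) -(val k l lt) -scaleN1r dotDr dotZr; ring.
apply: (@dual_basis_dot_le0 _ _ _ (node M i - node M l) (node M j - node M l)).
- by rewrite dif // eqxx eq_sym (negPf li) subr0.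
- by rewrite dif // eq_sym (negPf ji) eq_sym (negPf li) subr0.
- by rewrite dif // (negPf ji) eq_sym (negPf lj) subr0.
- by rewrite dif // eqxx eq_sym (negPf lj) subr0.
apply/ltW/acute_angle_dot_gt0/(acM t) => //.
by rewrite eq_sym.
Qed.

Lemma pgrad_basis_mul0 i j x : ~~ neighbor i j -> j != i ->
  pgrad M (phi j) x = 0 \/ phi i x = 0.
Proof.
move=> nij ij.
have [[t tM tx]|nt] := pselect (exists2 t, t \in tri M & interior (cell t) x);
  last by left; exact: pgrad_outside.
case: (neighborN nij ij tM) => h; [right|left].
  exact: (basis_support tM (interior_subset tx)).
exact: (pgrad_support tM tx).
Qed.

End Basis.
End PiecewiseLinear.

(** * Signs and row sums of the finite element matrices *)

Section Matrices.
Context {R : realType} (Omega : set (R * R)) (M : mesh R).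
Local Notation N := (nlast M).+1.
Variable phi : 'I_N -> R * R -> R.
Hypotheses (openO : open Omega) (bndO : bounded_set Omega).
Hypotheses (confM : conforming Omega M) (phiB : nodal_basis Omega phi).
Implicit Types (i j : 'I_N) (tau : 'M[R]_N).
Local Notation bm f := (bounded_measurable (Omega : set (measurableTypeR R * measurableTypeR R)) f).
Local Notation intO f := ((leb2 R).-integrable Omega (EFin \o f)).

Let mO : measurable (Omega : set (measurableTypeR R * measurableTypeR R)).
Proof. exact: open_measurable_plane. Qed.

Let finO : (leb2 R Omega < +oo)%E.
Proof. exact: bounded_measure_lty. Qed.

Let ge0 i x : Omega x -> 0 <= phi i x.
Proof. by move=> /subset_closure; exact: (basis_ge0 confM phiB). Qed.

Lemma piecewise_linear_continuous v : piecewise_linear Omega M v ->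
  {in Omega, continuous v}.
Proof.
move=> [cv _]; rewrite -continuous_open_subspace //.
by apply: (continuous_subspaceW _ cv); exact: subset_closure.
Qed.

Lemma bounded_measurable_basis i : bm (phi i).
Proof.
split.
  apply: continuous_measurable_plane => //.
  by apply: piecewise_linear_continuous; case: (phiB i).
exists 1 => x Ox; rewrite ger0_norm ?ge0 //.
by apply: (basis_le1 confM phiB); exact: subset_closure.
Qed.

Lemma bounded_measurable_pgrad i (u : R * R) : bm (fun x => dot u (pgrad M (phi i) x)).
Proof.
have h (t : {set 'I_N}) : exists g : R * R, t \in tri M ->
    forall x, interior (cell t) x -> pgrad M (phi i) x = g.
  have [tM|] := boolP (t \in tri M); last by exists 0.
  by have [g [_ [_ E]]] := pgrad_cell phiB tM; exists (g i) => _ x; exact: E.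
have [g gE] := choice h; split.
  apply: (measurable_funS measurableT) => //.
  apply: (@measurable_fun_step _ _ _ _
    (fun t => if t \in tri M then interior (cell t) else set0) _ 0) => [t|t x y|x nt].
  - by case: ifP => // _; apply: open_measurable_plane; exact: open_interior.
  - by case: ifP => // tM tx ty; rewrite !(gE t).
  - rewrite pgrad_outside; first by rewrite dotC dot0l.
    by move=> [t tM tx]; apply: (nt t); rewrite tM.
exists (\sum_t `|dot u (g t)|) => x _.
have [[t tM tx]|nt] := pselect (exists2 t, t \in tri M & interior (cell t) x).
  rewrite (gE t) // (bigD1 t) //= lerDl.
  by apply: sumr_ge0.
by rewrite pgrad_outside // dotC dot0l normr0; apply: sumr_ge0.
Qed.

Lemma Mmx_ge0 i j : 0 <= Mmx Omega phi i j.
Proof.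
by rewrite mxE; apply: Rintegral_ge0 => x Ox; rewrite mulr_ge0 ?ge0.
Qed.

Lemma weights_Mmx : weights (Mmx Omega phi).
Proof.
move=> i j ij; split; first exact: Mmx_ge0.
move=> nij; rewrite mxE; apply: Rintegral_eq0 => // x Ox.
by apply: (basis_mul0 confM phiB) => //; exact: subset_closure.
Qed.

(** By continuity [phi i > 1/2] on an open set [U] around the interior node, so the diagonal entry
    is at least a quarter of the positive measure of [U]. Its finiteness is checked too, as [fine]
    would turn an infinite integral into 0. *)
Lemma lumped_mass_gt0 i : interior_node Omega i -> 0 < \sum_j Mmx Omega phi i j.
Proof.
move=> /asboolP Oi; rewrite (bigD1 i) //= ltr_pwDl //; last first.
  by apply: sumr_ge0 => j _; exact: Mmx_ge0.
pose U := interior (Omega `&` [set x | 2^-1 < phi i x]).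
have Ui : U (node M i).
  apply: filterI; first exact: open_nbhs_nbhs.
  have c := piecewise_linear_continuous (proj1 (phiB i)) (mem_set Oi).
  apply: (c [set y | 2^-1 < y]); apply: open_nbhs_nbhs; split.
    exact: open_gt.
  by rewrite /= (basis_node phiB) eqxx /= invf_lt1 // ltr1n.
have oU : open U by exact: open_interior.
have UO : U `<=` Omega by move=> x /interior_subset[].
have U0 : (0 < leb2 R U)%E by apply: open_measure_gt0 => //; exists (node M i).
have mU : measurable (U : set (measurableTypeR R * measurableTypeR R)).
  exact: open_measurable_plane.
have bb := bounded_measurableM (bounded_measurable_basis i) (bounded_measurable_basis i).
have intM := bounded_measurable_integrable mO finO bb.
rewrite mxE /ip /Rintegral fine_gt0 //; apply/andP; split; last first.
  by have /fin_numPlt/andP[] := integrable_fin_num mO intM.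
apply: (@lt_le_trans _ _ (\int[leb2 R]_(x in U) (4^-1)%:E)%E).
  rewrite integral_cst // mule_gt0 // lte_fin; lra.
apply: (@le_trans _ _ (\int[leb2 R]_(x in U) (phi i x * phi i x)%:E)%E).
  apply: ge0_le_integral => //.
    by apply/measurable_EFinP; exact: (measurable_funS mO UO bb.1).
  by move=> x /interior_subset[_ /= hx]; rewrite lee_fin; nra.
apply: ge0_subset_integral => //.
  by apply/measurable_EFinP; exact: bb.1.
by move=> x _; rewrite lee_fin -expr2 sqr_ge0.
Qed.

Lemma dot_pgrad_integrable i (u v : R * R -> R) :
  intO u -> intO v ->
  intO (fun x => dot (u x, v x) (pgrad M (phi i) x)).
Proof.
move=> intu intv; rewrite /dot /=.
(* The unit vectors extract the two components of the gradient. *)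
have e1 := bounded_measurable_pgrad i (1, 0).
have e2 := bounded_measurable_pgrad i (0, 1).
have := integrableD_EFin mO (integrable_mul mO intu e1) (integrable_mul mO intv e2).
congr (integrable _ _ (EFin \o _)); apply/funext => x; rewrite /dot /=; ring.
Qed.

Lemma Smx_integrable i j : intO (fun x => dot (pgrad M (phi i) x) (pgrad M (phi j) x)).
Proof.
have e1 := bounded_measurable_integrable mO finO (bounded_measurable_pgrad i (1, 0)).
have e2 := bounded_measurable_integrable mO finO (bounded_measurable_pgrad i (0, 1)).
have := dot_pgrad_integrable j e1 e2.
congr (integrable _ _ (EFin \o _)); apply/funext => x; rewrite /dot /=; ring.
Qed.

Lemma Smx_le0 i j : acute M -> j != i -> Smx Omega phi i j <= 0.
Proof.
move=> acM ij; rewrite mxE; apply: Rintegral_ae_le0 => //.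
  by apply/measurable_EFinP; have /integrableP[] := Smx_integrable i j.
by apply: aeW => x _; exact: (pgrad_dot_le0 confM phiB).
Qed.

Lemma dot_sumr (u : R * R) (v : 'I_N -> R * R) :
  dot u (\sum_j v j) = \sum_j dot u (v j).
Proof.
elim/big_rec2: _ => [|j x y _ <-]; first by rewrite dotC dot0l.
by rewrite dotDr.
Qed.

Lemma Smx_row_sum i : \sum_j Smx Omega phi i j = 0.
Proof.
under eq_bigr do rewrite mxE.
rewrite -(Rintegral_sum mO finO _ (fun j => Smx_integrable i j)).
apply: Rintegral_eq0 => // x _.
by rewrite -dot_sumr (sum_pgrad confM phiB) dotC dot0l.
Qed.

Section Convection.
Variable b : R * R -> R * R.
Hypotheses (b1 : Lp_on (leb2 R) +oo%E Omega (fun x => (b x).1))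
  (b2 : Lp_on (leb2 R) +oo%E Omega (fun x => (b x).2)).

Lemma Tmx_integrable i j :
  intO (fun x => dot (b x) (pgrad M (phi j) x) * phi i x).
Proof.
apply: integrable_mul (bounded_measurable_basis i) => //.
exact: (dot_pgrad_integrable j
  (Loo_on_integrable mO finO b1) (Loo_on_integrable mO finO b2)).
Qed.

(** Boundedness of [b] makes the entries integrals of integrable functions, so the row sum is the
    integral of [b] against the gradient of the constant 1. *)
Lemma Tmx_row_sum i : \sum_j Tmx Omega phi b i j = 0.
Proof.
under eq_bigr do rewrite mxE.
rewrite -(Rintegral_sum mO finO _ (fun j => Tmx_integrable i j)).
apply: Rintegral_eq0 => // x _.
by rewrite -mulr_suml -dot_sumr (sum_pgrad confM phiB) dotC dot0l mul0r.
Qed.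

End Convection.

Lemma Tmx_neighbor b i j : ~~ neighbor i j -> j != i -> Tmx Omega phi b i j = 0.
Proof.
move=> nij ij; rewrite mxE; apply: Rintegral_eq0 => // x Ox.
have [->|->] := pgrad_basis_mul0 phiB x nij ij.
  by rewrite dotC dot0l mul0r.
by rewrite mulr0.
Qed.

Lemma rvec_le0 s i : intO s -> nonpos_in Omega s -> rvec Omega phi s i 0 <= 0.
Proof.
move=> ints s0; rewrite mxE.
exact: (Rintegral_mul_ae_le0 mO ints (bounded_measurable_basis i) (ge0 i)).
Qed.

Lemma rvec_ge0 s i : intO s -> nonneg_in Omega s -> 0 <= rvec Omega phi s i 0.
Proof.
move=> ints s0; rewrite mxE.
exact: (Rintegral_mul_ae_ge0 mO ints (bounded_measurable_basis i) (ge0 i)).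
Qed.

Lemma cellwise_affine_integrable v : cellwise_affine M v -> intO v.
Proof.
move=> av; have intb j := bounded_measurable_integrable mO finO (bounded_measurable_basis j).
have : intO (fun x => \sum_j v (node M j) * phi j x).
  by apply: (integrable_sum_EFin mO finO) => j; exact: (integrableZ_EFin mO).
apply: eq_integrable => // x /set_mem Ox /=.
by rewrite -(interpolation confM phiB av (subset_closure Ox)).
Qed.

(** Turns the right-hand side of the adjoint equation into a load vector whose sign is given. The
    consistent mass matrix matters here: applied to nodal values, it yields exactly the load vector
    of the interpolated function. *)
Lemma Mmx_mul_coefs v s i : cellwise_affine M v -> L2 Omega s ->
  (Mmx Omega phi *m coefs M v - rvec Omega phi s) i 0 =
  rvec Omega phi (fun x => v x - s x) i 0.
Proof.
move=> av s2; rewrite !mxE.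
have ints := L2_on_integrable mO finO s2.
have bb j := bounded_measurableM (bounded_measurable_basis i) (bounded_measurable_basis j).
have intm j : intO (fun x => v (node M j) * (phi i x * phi j x)).
  exact: (integrableZ_EFin mO _ (bounded_measurable_integrable mO finO (bb j))).
have vE x : Omega x -> v x * phi i x = \sum_j v (node M j) * (phi i x * phi j x).
  move=> Ox; rewrite (interpolation confM phiB av (subset_closure Ox)) mulr_suml.
  by apply: eq_bigr => j _; ring.
have intv := integrable_mul mO (cellwise_affine_integrable av) (bounded_measurable_basis i).
rewrite [RHS](_ : _ = \int[leb2 R]_(x in Omega) (v x * phi i x - s x * phi i x)); last first.
  by apply: eq_Rintegral => x _; rewrite mulrBl.
rewrite RintegralB //; last exact: (integrable_mul mO ints (bounded_measurable_basis i)).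
congr (_ - _).
transitivity (\int[leb2 R]_(x in Omega) (\sum_j v (node M j) * (phi i x * phi j x))).
  rewrite (Rintegral_sum mO finO _ intm); apply: eq_bigr => j _.
  rewrite !mxE RintegralZl // 1?mulrC //.
  exact: (bounded_measurable_integrable mO finO (bb j)).
by apply: eq_Rintegral => x /set_mem Ox; rewrite vE.
Qed.

End Matrices.

(** * Stabilized matrices *)

Section Stabilization.
Context {R : realType} (M : mesh R).
Local Notation N := (nlast M).+1.
Implicit Types (tau : 'M[R]_N) (i j : 'I_N).

Lemma neighbor_sym i j : neighbor i j = neighbor j i.
Proof.
rewrite /neighbor eq_sym; congr (_ && _).
by apply: eq_existsb => t; rewrite [_ && (j \in t)]andbC.
Qed.

Lemma zero_row_sumE (e : 'I_N -> 'I_N -> R) i : \sum_j zero_row_sum e i j = 0.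
Proof.
rewrite (bigD1 i) //= !mxE eqxx.
rewrite [X in _ + X](eq_bigr (e i)) ?addNr // => j ji.
by rewrite mxE eq_sym (negPf ji).
Qed.

Lemma DmxE tau i j : j != i ->
  Dmx tau i j = Num.min (- tau i j) (Num.min 0 (- tau j i)).
Proof. by move=> ij; rewrite mxE eq_sym (negPf ij). Qed.

Lemma DhmxE tau i j : j != i ->
  Dhmx tau i j = Num.max (- tau i j) (Num.max 0 (- tau j i)).
Proof. by move=> ij; rewrite mxE eq_sym (negPf ij). Qed.

Variable T : 'M[R]_N.
Hypothesis TN : forall i j, ~~ neighbor i j -> j != i -> T i j = 0.

Lemma Dmx_le0 i j : j != i -> Dmx T i j <= 0.
Proof. by move=> ij; rewrite DmxE // !ge_min lexx orbT. Qed.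

(** An entry of [Dmx] involves both [T i j] and [T j i]; both vanish off the mesh edges because
    adjacency is symmetric. *)
Lemma weights_Dmx : weights (map_mx Num.norm (Dmx T)).
Proof.
move=> i j ij; rewrite mxE; split=> // nij.
by rewrite DmxE // !TN // 1?eq_sym 1?neighbor_sym // oppr0 !minxx normr0.
Qed.

Lemma weights_Dhmx : weights (Dhmx T).
Proof.
move=> i j ij; rewrite DhmxE //; split; first by rewrite !le_max lexx orbT.
by move=> nij; rewrite !TN // 1?eq_sym 1?neighbor_sym // oppr0 !maxxx.
Qed.

Variables (S : 'M[R]_N) (mu : R).
Hypotheses (mu0 : 0 <= mu) (S0 : forall i j, j != i -> S i j <= 0)
  (sS : forall i, \sum_j S i j = 0) (sT : forall i, \sum_j T i j = 0).

Let mx3 (A B C : 'M[R]_N) i j : (A + B + C) i j = A i j + B i j + C i j.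
Proof. by rewrite !mxE. Qed.

Let mxN (A : 'M[R]_N) i j : (- A) i j = - A i j.
Proof. by rewrite mxE. Qed.

Let mxZ (A : 'M[R]_N) i j : (mu *: A) i j = mu * A i j.
Proof. by rewrite mxE. Qed.

Let sum_mx3 (A B C : 'M[R]_N) i : \sum_j (A + B + C) i j =
  \sum_j A i j + \sum_j B i j + \sum_j C i j.
Proof. by rewrite -!big_split; apply: eq_bigr => j _; rewrite mx3. Qed.

(** The first argument of the minimum defining [Dmx] is [- T i j], so the artificial diffusion
    outweighs a positive convection entry. *)
Lemma state_matrix_le0 i j : j != i -> (mu *: S + T + Dmx T) i j <= 0.
Proof.
move=> ij; have := mulr_ge0_le0 mu0 (S0 ij).
have : Dmx T i j <= - T i j by rewrite DmxE // ge_min lexx.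
by rewrite mx3 mxZ; lra.
Qed.

Lemma state_matrix_row_sum i : \sum_j (mu *: S + T + Dmx T) i j = 0.
Proof.
rewrite sum_mx3 zero_row_sumE sT !addr0.
by under eq_bigr do rewrite mxZ; rewrite -mulr_sumr sS mulr0.
Qed.

(** Convection enters with the opposite sign, which is why the maximum in [Dhmx] replaces the
    minimum and is subtracted. *)
Lemma adjoint_matrix_le0 i j : j != i -> (mu *: S - T - Dhmx T) i j <= 0.
Proof.
move=> ij; have := mulr_ge0_le0 mu0 (S0 ij).
have : - T i j <= Dhmx T i j by rewrite DhmxE // le_max lexx.
by rewrite mx3 !mxN mxZ; lra.
Qed.

Lemma adjoint_matrix_row_sum i : \sum_j (mu *: S - T - Dhmx T) i j = 0.
Proof.
have sN (A : 'M[R]_N) : \sum_j (- A) i j = - \sum_j A i j.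
  by rewrite -sumrN; apply: eq_bigr => j _; rewrite mxN.
rewrite sum_mx3 !sN zero_row_sumE sT oppr0 !addr0.
by under eq_bigr do rewrite mxZ; rewrite -mulr_sumr sS mulr0.
Qed.

End Stabilization.

(** * The scheme as two instances of the abstract step *)

(** Every node is a vertex of some cell and hence in the closure; if it is not in the open set
    [Omega], it is on the boundary. *)
Lemma Sh_boundary_node (R : realType) (Omega : set (R * R)) (M : mesh R)
    (v : R * R -> R) (i : 'I_(nlast M).+1) :
  open Omega -> conforming Omega M -> Sh Omega M v ->
  ~~ interior_node Omega i -> coefs M v i 0 = 0.
Proof.
move=> oO confM [_ v0] /asboolPn nOi; rewrite mxE; apply: v0.
split; last by move=> /interior_subset.
case: (confM) => _ _ /(_ i)[t tM it] _ _.
exact: (cell_closure confM tM (node_cell it)).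
Qed.

Lemma source_integrable (R : realType) (p : ocp R) N0 (U : nat -> R * R -> R) n :
  standing_assumptions p -> 0 <= tlev p N0 n <= Tend p -> L2 (Omega p) (U n) ->
  (leb2 R).-integrable (Omega p) (EFin \o source p N0 U n).
Proof.
move=> [[oO _ _ bO _] _ _ _ [data [_ [_ _ ctrl]]]] tn U2.
have mO := open_measurable_plane oO; have finO := bounded_measure_lty oO bO.
have [[B2 _ _] _ _] := ctrl _ tn; have [G2 _] := data _ tn.
apply: (integrableD_EFin mO); apply: (L2_on_integrable mO finO) => //.
exact: B2.
Qed.

Theorem theorem3p2 (R : realType) (p : ocp R) (F : set (mesh R)) (M : mesh R)
    (phi : 'I_(nlast M).+1 -> R * R -> R) (N0 : nat) (eb eB : bool)
    (Y0 : R * R -> R) (Y P U : nat -> R * R -> R)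
    (hp : standing_assumptions p)
    (hF : mesh_family (Omega p) F) (hM : F M)
    (hphi : nodal_basis (Omega p) phi)
    (hN0 : (1 <= N0)%N)
    (hY0 : Sh (Omega p) M Y0)
    (hsol : afc_solution p phi N0 eb eB Y0 Y P U)
    (n : nat) (hn : (1 <= n <= N0)%N)
    (i : 'I_(nlast M).+1) (hi : interior_node (Omega p) i) :
  let alpha := fun m => coefs M (Y m) in
  let beta := fun m => coefs M (P m) in
  let GBU := source p N0 U n in
  let Ydiff := fun x => Y n x - ydfun p (tlev p N0 n) x in
  (0 < sigma p ->
    [/\ nonpos_in (Omega p) GBU ->
          alpha n i 0 <= Num.max 0 (vmax (alpha n.-1)),
        nonneg_in (Omega p) GBU ->
          Num.min 0 (vmin (alpha n.-1)) <= alpha n i 0,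
        nonpos_in (Omega p) Ydiff ->
          beta n.-1 i 0 <= Num.max 0 (vmax (beta n)) &
        nonneg_in (Omega p) Ydiff ->
          Num.min 0 (vmin (beta n)) <= beta n.-1 i 0]) /\
  (sigma p = 0 ->
    [/\ nonpos_in (Omega p) GBU -> alpha n i 0 <= vmax (alpha n.-1),
        nonneg_in (Omega p) GBU -> vmin (alpha n.-1) <= alpha n i 0,
        nonpos_in (Omega p) Ydiff -> beta n.-1 i 0 <= vmax (beta n) &
        nonneg_in (Omega p) Ydiff -> vmin (beta n) <= beta n.-1 i 0]).
Proof.
move=> alpha beta GBU Ydiff.
have [[oO _ _ bO _] T0 [mu0 sig0 _ _] [sg _ field] [data _]] := hp.
have [/(_ _ hM)[confM acM] _ _] := hF.
have [[YPSh U2] _ _ eqns _] := hsol.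
have [n1 nN0] := andP hn.
have mO := open_measurable_plane oO; have finO := bounded_measure_lty oO bO.
have N0R : 0 < N0%:R :> R by rewrite ltr0n.
have k0 : 0 <= tstep p N0 by rewrite divr_ge0 // ltW.
have tB m : (m <= N0)%N -> 0 <= tlev p N0 m <= Tend p.
  move=> mN0; rewrite /tlev mulr_ge0 //= /tstep mulrCA.
  by rewrite ler_piMr ?(ltW T0) // ler_pdivrMr // mul1r ler_nat.
have Sh0 v w : Sh (Omega p) M v -> Sh (Omega p) M w -> forall j : 'I_(nlast M).+1,
    ~~ interior_node (Omega p) j -> coefs M v j 0 = 0 /\ coefs M w j 0 = 0.
  by move=> Sv Sw j nj; split; apply: (Sh_boundary_node oO confM).
have TE t (tT : 0 <= t <= Tend p) j : \sum_l Tmx (Omega p) phi (bfield p t) j l = 0.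
  have [g1 [g2 [[b1 _ _ _] [b2 _ _ _] _]]] := field t tT.
  exact: (Tmx_row_sum oO bO confM hphi b1 b2).
have TN t j l : ~~ neighbor j l -> l != j -> Tmx (Omega p) phi (bfield p t) j l = 0.
  exact: (Tmx_neighbor oO hphi).
have S0 j l : l != j -> Smx (Omega p) phi j l <= 0.
  exact: (Smx_le0 oO bO confM hphi acM).
have SE := Smx_row_sum oO bO confM hphi.
have bd := exists_boundary_node confM oO.
have wM := weights_Mmx oO confM hphi.
have m0 j : interior_node (Omega p) j ->
    0 < (\row_l (\sum_q Mmx (Omega p) phi l q)) 0 j.
  by move=> Oj; rewrite mxE; exact: (lumped_mass_gt0 oO bO confM hphi).
have n1N0 : (n.-1 <= N0)%N by rewrite (leq_trans (leq_pred n)).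
have nebN0 : (n - eb <= N0)%N by rewrite (leq_trans (leq_subr _ _)).
have [[YnSh PnSh] [Yn1Sh Pn1Sh]] := (YPSh n nN0, YPSh n.-1 n1N0).
have intG := source_integrable hp (tB n nN0) (U2 n hn).
have [_ yd2] := data _ (tB n nN0).
have aY : cellwise_affine M (Y n) by case: YnSh => -[].
have intY : (leb2 R).-integrable (Omega p) (EFin \o Ydiff).
  have := integrableB mO (cellwise_affine_integrable oO bO confM hphi aY)
    (L2_on_integrable mO finO yd2).
  by congr (integrable _ _ _); apply/funext => x /=; rewrite EFinB.
set m := \row_l (\sum_q Mmx (Omega p) phi l q) in m0.
set S := Smx (Omega p) phi in S0 SE.
pose T1 := Tmx (Omega p) phi (bfield p (tlev p N0 n)).
(* The field may be taken at level n or n-1. Both lie in [0, T], where the row sums of the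
   convection matrix vanish. *)
pose T2 := Tmx (Omega p) phi (bfield p (tlev p N0 (n - eb))).
have state :
    afc_step (Omega p) (mu p *: S + T1 + Dmx T1) (map_mx Num.norm (Dmx T1))
      (Mmx (Omega p) phi) m (tstep p N0) (sigma p)
      (alpha n) (alpha n.-1) (rvec (Omega p) phi GBU).
  move=> j Oj; have [+ _] := eqns n j hn Oj.
  rewrite /state_equation gbar_flux fbar_flux //.
  by move=> l q; exact: Dmx_le0.
have adj :
    afc_step (Omega p) (mu p *: S - T2 - Dhmx T2) (Dhmx T2)
      (Mmx (Omega p) phi) m (tstep p N0) (sigma p)
      (beta n.-1) (beta n) (rvec (Omega p) phi Ydiff).
  move=> j Oj; have [_ +] := eqns n j hn Oj.
  rewrite /adjoint_equation gbar_flux fhbar_flux => ->.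
  have -> : rvec (Omega p) phi Ydiff =
      Mmx (Omega p) phi *m alpha n - rvec (Omega p) phi (ydfun p (tlev p N0 n)).
    apply/colP => l; apply/esym.
    exact: (Mmx_mul_coefs oO bO confM hphi l aY yd2).
  by rewrite scalerBr addrA.
have mu1 := ltW mu0.
have K1 := state_matrix_le0 T1 mu1 S0.
have K2 := adjoint_matrix_le0 T2 mu1 S0.
have sK1 := state_matrix_row_sum (mu p) SE (TE _ (tB n nN0)).
have sK2 := adjoint_matrix_row_sum (mu p) SE (TE _ (tB _ nebN0)).
have c1 : weights (map_mx Num.norm (Dmx T1)) := weights_Dmx (TN _).
have c2 : weights (Dhmx T2) := weights_Dhmx (TN _).
have bdY := Sh0 _ _ YnSh Yn1Sh; have bdP := Sh0 _ _ Pn1Sh PnSh.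
have Y_le (G0 : nonpos_in (Omega p) GBU) : alpha n i 0 <= vmax (alpha n.-1).
  exact: (afc_step_max k0 sig0 m0 K1 sK1 c1 wM bd bdY
    (fun j _ => rvec_le0 oO confM hphi j intG G0) state).
have Y_ge (G0 : nonneg_in (Omega p) GBU) : vmin (alpha n.-1) <= alpha n i 0.
  exact: (afc_step_min k0 sig0 m0 K1 sK1 c1 wM bd bdY
    (fun j _ => rvec_ge0 oO confM hphi j intG G0) state).
have P_le (G0 : nonpos_in (Omega p) Ydiff) : beta n.-1 i 0 <= vmax (beta n).
  exact: (afc_step_max k0 sig0 m0 K2 sK2 c2 wM bd bdP
    (fun j _ => rvec_le0 oO confM hphi j intY G0) adj).
have P_ge (G0 : nonneg_in (Omega p) Ydiff) : vmin (beta n) <= beta n.-1 i 0.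
  exact: (afc_step_min k0 sig0 m0 K2 sK2 c2 wM bd bdP
    (fun j _ => rvec_ge0 oO confM hphi j intY G0) adj).
split=> _; split=> // G0.
- by rewrite le_max Y_le ?orbT.
- by rewrite ge_min Y_ge ?orbT.
- by rewrite le_max P_le ?orbT.
- by rewrite ge_min P_ge ?orbT.
Qed.
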